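(* Let $(Q,\mathfrak{n})$ be a regular local ring and let $f_1,\ldots,f_c\in\mathfrak{n}^2$ be a $Q$-regular sequence such that the initial forms $f_1^*,\ldots,f_c^*$ form a $G(Q)$-regular sequence, where $G(Q)=\bigoplus_{i\ge 0}\mathfrak{n}^i/\mathfrak{n}^{i+1}$. Assume $\operatorname{ord}_Q(f_1)\ge \operatorname{ord}_Q(f_2)\ge\cdots\ge\operatorname{ord}_Q(f_c)$. Set $(A,\mathfrak{m})=(Q/(f_1,\ldots,f_c),\ \mathfrak{n}/(f_1,\ldots,f_c))$. Let $M$ be a finitely generated $A$-module of infinite projective dimension and let $(\mathbb{F},\partial)$ be a minimal free resolution of $M$ as an $A$-module. Then $\operatorname{ord}_A(\partial_i)\le \operatorname{ord}_Q(f_1)-1$ for all $i\gg 0$.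
   Context: For a Noetherian local ring $(A,\mathfrak{m})$ and $x\in\mathfrak{m}^i\setminus\mathfrak{m}^{i+1}$, $\operatorname{ord}_A(x)=i$, and $\operatorname{ord}_A(0)=+\infty$. For a nonzero element $x$ of $Q$, its initial form $x^*$ is its image in $\mathfrak{n}^j/\mathfrak{n}^{j+1}\subseteq G(Q)$ where $j=\operatorname{ord}_Q(x)$. For an $A$-linear map $\phi\colon F\to G$ of finite free $A$-modules written as a matrix $(a_{ij})$ with respect to some bases, if $\phi\neq 0$ then $\operatorname{ord}_A(\phi)=\max\{l \mid a_{ij}\in\mathfrak{m}^l \text{ for all } i,j\}$ (independent of the bases), and $\operatorname{ord}_A(0)=+\infty$. Here $\partial_i\colon F_i\to F_{i-1}$ are the differentials of the minimal free resolution. *)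

(* Defs.v *)
From mathcomp Require Import all_boot all_order all_algebra.
Set Implicit Arguments. Unset Strict Implicit. Unset Printing Implicit Defensive.
Import GRing.Theory.
Local Open Scope ring_scope.

Section CommAlg.
Variable Q : comNzRingType.

Definition is_ideal (P : Q -> Prop) : Prop :=
  P 0 /\ (forall x y, P x -> P y -> P (x + y)) /\ (forall r x, P x -> P (r * x)).

Definition gen_ideal (g : seq Q) (x : Q) : Prop :=
  exists r : nat -> Q, x = \sum_(j < size g) r j * nth 0 g j.

Definition ideal_add (P R : Q -> Prop) (x : Q) : Prop :=
  exists y z, P y /\ R z /\ x = y + z.

Fixpoint ideal_pow (n : Q -> Prop) (k : nat) : Q -> Prop :=
  match k with
  | 0 => fun _ => True
  | k'.+1 => fun x => exists s : seq (Q * Q),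
      (forall p, p \in s -> n p.1 /\ ideal_pow n k' p.2) /\
      x = \sum_(p <- s) p.1 * p.2
  end.

Definition noetherian : Prop :=
  forall P, is_ideal P -> exists g : seq Q, forall x, P x <-> gen_ideal g x.

Definition local_ring (n : Q -> Prop) : Prop :=
  is_ideal n /\ ~ n 1 /\ forall x, ~ n x -> exists y, x * y = 1.

Definition prime_ideal (P : Q -> Prop) : Prop :=
  is_ideal P /\ ~ P 1 /\ forall a b, P (a * b) -> P a \/ P b.

Definition has_prime_chain (d : nat) : Prop :=
  exists P : nat -> Q -> Prop,
    (forall i, (i <= d)%N -> prime_ideal (P i)) /\
    (forall i, (i < d)%N ->
       (forall x, P i x -> P i.+1 x) /\ exists x, P i.+1 x /\ ~ P i x).

Definition krull_dim (d : nat) : Prop :=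
  has_prime_chain d /\ ~ has_prime_chain d.+1.

Definition min_num_gens (n : Q -> Prop) (d : nat) : Prop :=
  (exists g : seq Q, size g = d /\ forall x, n x <-> gen_ideal g x) /\
  (forall g : seq Q, (size g < d)%N -> ~ (forall x, n x <-> gen_ideal g x)).

Definition regular_local_ring (n : Q -> Prop) : Prop :=
  noetherian /\ local_ring n /\
  exists d, krull_dim d /\ min_num_gens n d.

Definition regular_seq (f : seq Q) : Prop :=
  (forall i, (i < size f)%N -> forall x,
      gen_ideal (take i f) (nth 0 f i * x) -> gen_ideal (take i f) x) /\
  ~ gen_ideal f 1.

(* Homogeneous elements of G(Q) = (+)_k n^k/n^(k+1).  Given x in n^k (so that
   x^* := class of x in n^k/n^(k+1) is a homogeneous element of degree k),
   [gr_in n f e i k x] says that x^* lies in the ideal generated by f_0^*, ..., f_(i-1)^* of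
   G(Q), where e_j = ord_Q(f_j): i.e. x* = sum_j f_j^* y_j^* with y_j^* homogeneous
   of degree k - e_j (and y_j^* = 0 when k < e_j). *)
Definition gr_in (n : Q -> Prop) (f : seq Q) (e : seq nat) (i k : nat) (x : Q)
  : Prop :=
  exists y : nat -> Q,
    (forall j, (j < i)%N ->
       if (nth 0 e j <= k)%N then ideal_pow n (k - nth 0 e j) (y j) else y j = 0) /\
    ideal_pow n k.+1 (x - \sum_(j < i) nth 0 f j * y j).

(* f_0^*, ..., f_(c-1)^* is a G(Q)-regular sequence (regularity of a sequence of
   homogeneous elements of positive degree in the graded ring G(Q), tested on
   homogeneous elements; G(Q)/(f^* G(Q)) <> 0 is automatic since deg f_j^* > 0). *)
Definition gr_regular_seq (n : Q -> Prop) (f : seq Q) (e : seq nat) : Prop :=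
  forall i, (i < size f)%N -> forall (d : nat) (x : Q), ideal_pow n d x ->
    gr_in n f e i (d + nth 0 e i) (nth 0 f i * x) -> gr_in n f e i d x.

End CommAlg.

(* Main.v *)
(* Suppose the entries of d_(i+1) lie in m^p with p = ord f_1, and lift the resolution to a
   sequence of matrices D over Q.  Then D_i D_(i+1) = sum_l f_l t_l, with t_l the Eisenbud
   operators, and up to a multiple of f this product lies in n^(p+1).  Since the initial
   forms are G(Q)-regular, (f) meets n^(p+1) in sum_l f_l n^(p+1-e_l), and p+1-e_l > 0;
   since the syzygies of f have coefficients in (f), every t_l vanishes modulo n in
   degree i.  But Ext_A(M, k) is a Noetherian module over k[t_1, ..., t_c], so for i >> 0
   its component of degree i+2 is spanned by the images of the t_l: a contradiction.

   Noetherianity goes by induction on c: the cone of the last operator resolves M over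
   Q/(f_1, ..., f_(c-1)), its Ext contains Ext_A(M, k) modulo the last operator, and
   Hilbert's basis argument lifts the ascending chain condition.  For c = 0, Ext_Q(M, k)
   vanishes in high degrees, because n is generated by a regular sequence; that in turn
   comes from Krull's principal ideal theorem. *)
Require Import Defs.
From mathcomp Require Import all_boot all_order all_algebra.
From mathcomp Require Import ring.
From Stdlib Require Import Classical ClassicalEpsilon.
Set Implicit Arguments. Unset Strict Implicit. Unset Printing Implicit Defensive.
Import GRing.Theory.
Local Open Scope ring_scope.

Lemma dependent_choice (T : Type) (U : T -> Type) (P : forall x, U x -> Prop) :
  (forall x, exists y, P x y) -> exists h : forall x, U x, forall x, P x (h x).
Proof.
move=> H; exists (fun x => proj1_sig (constructive_indefinite_description _ (H x))).
by move=> x; case: constructive_indefinite_description.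
Qed.

Lemma uniform_bound (P : nat -> nat -> Prop) (K : nat) :
  (forall i m m', (m <= m')%N -> P i m -> P i m') ->
  (forall i, (i < K)%N -> exists m, P i m) ->
  exists m, forall i, (i < K)%N -> P i m.
Proof.
move=> mono; elim: K => [|K IH] H; first by exists 0%N.
have [m1 H1] := IH (fun i iK => H i (ltnW iK)).
have [m2 H2] := H K (ltnSn K).
exists (maxn m1 m2) => i; rewrite ltnS leq_eqVlt => /orP[/eqP->|iK].
  exact: mono (leq_maxr _ _) H2.
exact: mono (leq_maxl _ _) (H1 i iK).
Qed.

(** * Regular local rings *)

Section Ideals.
Variable Q : comNzRingType.
Implicit Types (I J P p q n : Q -> Prop) (x y a r s : Q).

Lemma is_ideal0 I : is_ideal I -> I 0. Proof. by case. Qed.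
Lemma is_idealD I x y : is_ideal I -> I x -> I y -> I (x + y).
Proof. by move=> [_ [H _]]; apply: H. Qed.
Lemma is_idealMl I r x : is_ideal I -> I x -> I (r * x).
Proof. by move=> [_ [_ H]]; apply: H. Qed.
Lemma is_idealMr I r x : is_ideal I -> I x -> I (x * r).
Proof. by rewrite mulrC; apply: is_idealMl. Qed.
Lemma is_idealN I x : is_ideal I -> I x -> I (- x).
Proof. by rewrite -mulN1r; apply: is_idealMl. Qed.
Lemma is_idealB I x y : is_ideal I -> I x -> I y -> I (x - y).
Proof. by move=> hI Ix Iy; apply: is_idealD => //; apply: is_idealN. Qed.
Lemma ideal_sum I (T : Type) (s : seq T) (A : pred T) (F : T -> Q) :
  is_ideal I -> (forall i, A i -> I (F i)) -> I (\sum_(i <- s | A i) F i).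
Proof.
move=> hI HF; elim/big_ind: _ => //; first exact: is_ideal0.
by move=> x y; apply: is_idealD.
Qed.

Lemma ideal_sum_seq I (T : eqType) (s : seq T) (F : T -> Q) :
  is_ideal I -> (forall i, i \in s -> I (F i)) -> I (\sum_(i <- s) F i).
Proof. by move=> hI HF; rewrite big_seq; apply: ideal_sum. Qed.

Lemma ideal_subK I x y : is_ideal I -> I (x - y) -> I y -> I x.
Proof. by move=> hI h1 h2; rewrite -(subrK y x); apply: is_idealD. Qed.

Definition adjoin I a x := exists r, I (x - r * a).

Lemma adjoin_ideal I a : is_ideal I -> is_ideal (adjoin I a).
Proof.
move=> hI; split; first by exists 0; rewrite mul0r subr0; apply: is_ideal0.
split=> [x y [r Hr] [s Hs]|c x [r Hr]].
  exists (r + s); rewrite mulrDl opprD addrACA; exact: is_idealD.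
by exists (c * r); rewrite -mulrA -mulrBr; apply: is_idealMl.
Qed.

Lemma sub_adjoin I a x : I x -> adjoin I a x.
Proof. by move=> Ix; exists 0; rewrite mul0r subr0. Qed.

Lemma adjoin_mem I a r : is_ideal I -> adjoin I a (r * a).
Proof. by move=> hI; exists r; rewrite subrr; apply: is_ideal0. Qed.

Lemma adjoin_mem1 I a : is_ideal I -> adjoin I a a.
Proof. by move=> hI; rewrite -[X in adjoin _ _ X]mul1r; apply: adjoin_mem. Qed.

Lemma adjoinS I J a x : (forall y, I y -> J y) -> adjoin I a x -> adjoin J a x.
Proof. by move=> IJ [r /IJ]; exists r. Qed.

Lemma adjoin_sub I J a x : is_ideal J -> (forall y, I y -> J y) -> J a ->
  adjoin I a x -> J x.
Proof.
move=> hJ IJ Ja [r /IJ Hr]; apply: ideal_subK Hr _ => //; exact: is_idealMl.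
Qed.

Lemma gen_ideal_ideal (g : seq Q) : is_ideal (gen_ideal g).
Proof.
split; first by exists (fun _ => 0); rewrite big1 // => i _; rewrite mul0r.
split=> [x y [r ->] [s ->]|c x [r ->]].
  exists (fun i => r i + s i); rewrite -big_split; apply: eq_bigr => i _.
  by rewrite mulrDl.
exists (fun i => c * r i); rewrite mulr_sumr; apply: eq_bigr => i _.
by rewrite mulrA.
Qed.

Lemma gen_ideal_sub I (g : seq Q) x : is_ideal I ->
  (forall j, (j < size g)%N -> I (nth 0 g j)) -> gen_ideal g x -> I x.
Proof.
move=> hI Hg [r ->]; apply: ideal_sum => // j _; apply: is_idealMl => //; exact: Hg.
Qed.

Lemma gen_ideal_nth (g : seq Q) j : (j < size g)%N -> gen_ideal g (nth 0 g j).
Proof.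
move=> jg; exists (fun i => (i == j)%:R).
rewrite (bigD1 (Ordinal jg)) //= eqxx mul1r big1 ?addr0 // => i.
by rewrite -val_eqE /= => /negbTE ->; rewrite mul0r.
Qed.

(** * Chain conditions and localization at a prime *)

Lemma noetherian_acc : noetherian Q -> forall J : nat -> Q -> Prop,
  (forall k, is_ideal (J k)) -> (forall k x, J k x -> J k.+1 x) ->
  exists m, forall k x, J k x -> J m x.
Proof.
move=> noeth J hJ mono.
have mono' k k' x : (k <= k')%N -> J k x -> J k' x.
  by move=> /subnK <-; elim: (k' - k)%N => // i IH Jx; apply/mono/IH.
have hU : is_ideal (fun x => exists k, J k x).
  split; first by exists 0%N; apply: is_ideal0.
  split=> [x y [k Hx] [l Hy]|r x [k Hx]]; last by exists k; apply: is_idealMl.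
  exists (maxn k l); apply: is_idealD => //.
    exact: mono' (leq_maxl _ _) Hx.
  exact: mono' (leq_maxr _ _) Hy.
have [g Hg] := noeth _ hU.
have [m Hm] : exists m, forall j, (j < size g)%N -> J m (nth 0 g j).
  apply: (@uniform_bound (fun j m => J m (nth 0 g j))).
    by move=> i m m'; apply: mono'.
  by move=> j jg; apply/Hg/gen_ideal_nth.
exists m => k x Jx; apply: (@gen_ideal_sub (J m) g) => //.
by apply/Hg; exists k.
Qed.

Lemma noetherian_max : noetherian Q -> forall X : (Q -> Prop) -> Prop,
  (forall I, X I -> is_ideal I) -> (exists I, X I) ->
  exists I, X I /\ forall I', X I' -> (forall x, I x -> I' x) ->
    forall x, I' x -> I x.
Proof.
move=> noeth X hX [I0 XI0]; apply: NNPP => nomax.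
have step (I : {I | X I}) : exists I' : {I | X I},
    (forall x, sval I x -> sval I' x) /\ exists x, sval I' x /\ ~ sval I x.
  apply: NNPP => H; apply: nomax; exists (sval I); split; first exact: (svalP I).
  move=> I' XI' sub x I'x; apply: NNPP => nIx; apply: H.
  by exists (exist _ I' XI'); split=> //; exists x.
have [h Hh] := dependent_choice step.
pose J k := iter k h (exist _ I0 XI0).
have [m Hm] := @noetherian_acc noeth (fun k => sval (J k))
  (fun k => hX _ (svalP (J k))) (fun k x => (Hh (J k)).1 x).
by have [x [Jx nJx]] := (Hh (J m)).2; apply: nJx; apply: (Hm m.+1).
Qed.

(* The contraction of the localization of [I] at the prime [q]. *)
Definition saturation q I x := exists s, ~ q s /\ I (s * x).
Definition saturated q I := forall x, saturation q I x -> I x.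

Lemma prime_mulN q s r : prime_ideal q -> ~ q s -> ~ q r -> ~ q (s * r).
Proof. by move=> [_ [_ H]] hs hr /H []. Qed.

Lemma prime_expN q s m : prime_ideal q -> ~ q s -> ~ q (s ^+ m).
Proof.
move=> pq qs; elim: m => [|m IH]; first by rewrite expr0; case: pq => _ [].
by rewrite exprS; apply: prime_mulN.
Qed.

Lemma saturation_ideal q I : prime_ideal q -> is_ideal I -> is_ideal (saturation q I).
Proof.
move=> pq hI; split.
  by exists 1; split; [case: pq => _ [] | rewrite mulr0; apply: is_ideal0].
split=> [x y [s [Hs Ix]] [r [Hr Iy]]|c x [s [Hs Ix]]].
  exists (s * r); split; first exact: prime_mulN.
  rewrite mulrDr; apply: is_idealD => //; last by rewrite -mulrA; apply: is_idealMl.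
  by rewrite (mulrC s) -mulrA; apply: is_idealMl.
by exists s; split=> //; rewrite mulrCA; apply: is_idealMl.
Qed.

Lemma saturation_saturated q I : prime_ideal q -> saturated q (saturation q I).
Proof.
move=> pq x [s [Hs [r [Hr Ix]]]]; exists (r * s); split; first exact: prime_mulN.
by rewrite -mulrA.
Qed.

Lemma sub_saturation q I x : prime_ideal q -> I x -> saturation q I x.
Proof. by move=> [_ [H _]] Ix; exists 1; rewrite mul1r. Qed.

(* The hypothesis says that [J] is contained in [I + qJ] locally at [q]. *)
Lemma nakayama q I J : noetherian Q -> prime_ideal q -> is_ideal I -> saturated q I ->
  (forall K, is_ideal K -> (forall x, I x -> K x) ->
     (forall m x, q m -> J x -> K (m * x)) -> forall x, J x -> saturation q K x) ->
  forall x, J x -> I x.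
Proof.
move=> noeth pq hI sI HJ; apply: NNPP => nJI.
have [|K [[hK [sK [IK nJK]]] Kmax]] := @noetherian_max noeth (fun K => is_ideal K /\
    saturated q K /\ (forall x, I x -> K x) /\ ~ forall x, J x -> K x) (fun _ => @proj1 _ _).
  by exists I.
apply: nJK => x Jx; apply: (sK); apply: HJ x Jx => // m y qm Jy.
(* Otherwise maximality of [K] puts y in [K'], so s y - r m y lies in [K] with s outside q. As m is
   in q, s - r m is outside q too, and y lies in the saturated ideal [K]. *)
apply: NNPP => nKmy; pose K' := saturation q (adjoin K (m * y)).
have hK' : is_ideal K' by apply/saturation_ideal/adjoin_ideal.
have KK' z : K z -> K' z by move=> Kz; apply/sub_saturation/sub_adjoin.
have JK' : forall z, J z -> K' z.
  apply: NNPP => nJK'; apply: nKmy; apply: (Kmax K').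
  - by split=> //; split; [apply: saturation_saturated | split=> // z /IK /KK'].
  - exact: KK'.
  - by apply: sub_saturation => //; apply: adjoin_mem1.
have [s [Hs [r Hr]]] := JK' y Jy.
apply: nKmy; apply: is_idealMl => //; apply: sK; exists (s - r * m); split.
  move=> H; apply: Hs; have hq := proj1 pq; apply: ideal_subK H _ => //; exact: is_idealMl.
by rewrite mulrBl -mulrA.
Qed.

(** An associated prime of Q/I, found as a maximal colon ideal (I : c) with c outside I: if u c is
    outside I, then (I : u c) contains (I : c), so the two agree, and u v c in I forces v into (I :
    c). *)
Lemma colon_prime I : noetherian Q -> is_ideal I -> ~ I 1 ->
  exists c, ~ I c /\ prime_ideal (fun x => I (x * c)).
Proof.
move=> noeth hI I1.
have hcol c : is_ideal (fun x => I (x * c)).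
  split; first by rewrite mul0r; apply: is_ideal0.
  split=> [x y Hx Hy|r x Hx]; first by rewrite mulrDl; apply: is_idealD.
  by rewrite -mulrA; apply: is_idealMl.
have [||J [[c [nc Hc]] Jmax]] := @noetherian_max noeth
    (fun J => exists c, ~ I c /\ forall x, J x <-> I (x * c)).
- move=> J [c [_ Hc]]; have [h0 [hD hM]] := hcol c.
  split; first exact/Hc.
  by split=> [x y /Hc Hx /Hc Hy|r x /Hc Hx]; apply/Hc; [apply: hD | apply: hM].
- by exists (fun x => I (x * 1)), 1.
exists c; split=> //; split=> //; split; first by rewrite mul1r.
move=> u v Huv; case: (classic (I (u * c))) => Hu; [by left | right].
apply/Hc; apply: (Jmax (fun x => I (x * (u * c)))).
- by exists (u * c).
- by move=> x /Hc Hx; rewrite mulrCA; apply: is_idealMl.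
- by rewrite mulrA (mulrC v).
Qed.

(* Localized at [q], the ring [Q/I] is Artinian. *)
Lemma saturated_dcc q I (J : nat -> Q -> Prop) :
  noetherian Q -> prime_ideal q ->
  (forall p, prime_ideal p -> (forall x, I x -> p x) -> (forall x, p x -> q x) ->
     forall x, q x -> p x) ->
  (forall k, is_ideal (J k)) -> (forall k, saturated q (J k)) ->
  (forall k x, I x -> J k x) -> (forall k x, J k.+1 x -> J k x) -> is_ideal I ->
  exists m, forall k, (m <= k)%N -> forall x, J m x -> J k x.
Proof.
move=> noeth pq qmin hJ sJ IJ mono hI.
have mono' k k' x : (k <= k')%N -> J k' x -> J k x.
  by move=> /subnK <-; elim: (k' - k)%N => // i IH /mono /IH.
(* Noetherian induction on the ideals on which the chain becomes stationary. A maximal one is the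
   unit ideal, since otherwise some c outside [K] with q c inside [K] could be adjoined to it. *)
pose good K := exists m, forall k, (m <= k)%N -> forall x, K x -> J m x -> J k x.
have [||K [[hK [IK [m Hm]]] Kmax]] := @noetherian_max noeth
    (fun K => is_ideal K /\ (forall x, I x -> K x) /\ good K).
- by move=> K [].
- by exists I; split=> //; split=> //; exists 0%N => k _ x /(IJ k).
case: (classic (K 1)) => K1.
  by exists m => k mk x; apply: Hm => //; rewrite -(mulr1 x); apply: is_idealMl.
have sK x : saturation q K x -> K x.
  apply: Kmax x; last by move=> x; apply: sub_saturation.
  split; first exact: saturation_ideal.
  split; first by move=> x Ix; apply/sub_saturation/IK.
  exists m => k mk x [s [Hs Kx]] Jx; apply: sJ; exists s; split=> //.
  by apply: Hm => //; apply: is_idealMl.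
have [c [Kc pc]] := colon_prime noeth hK K1.
have qc x : q x -> K (x * c).
  apply: (qmin _ pc) => y; first by move=> /IK Ky; apply: is_idealMr.
  by move=> Kyc; apply: NNPP => qy; apply: Kc; apply: sK; exists y.
case: Kc; apply: (Kmax (adjoin K c)); first last.
- exact: adjoin_mem1.
- exact: sub_adjoin.
split; first exact: adjoin_ideal.
split; first by move=> x /IK; apply: sub_adjoin.
(* Either every [J k] contains c up to [K] and a factor outside q, or from some [k0] on the elements
   of [J k] in K + (c) already lie in [K]. *)
case: (classic (forall k, exists s, ~ q s /\ exists z, K z /\ J k (s * c + z))) => hits.
- exists m => k mk x [r Kr] Jx; have [s [Hs [z [Kz Jz]]]] := hits k.
  apply: sJ; exists s; split=> //.
  have -> : s * x = (s * (x - r * c) - r * z) + r * (s * c + z) by ring.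
  apply: is_idealD => //; last exact: is_idealMl.
  apply: Hm => //; first by apply: is_idealB => //; apply: is_idealMl.
  have -> : s * (x - r * c) - r * z = s * x - r * (s * c + z) by ring.
  by apply: is_idealB => //; [apply: is_idealMl | apply: is_idealMl => //; apply: mono' Jz].
- have [k0 Hk0] : exists k0, ~ exists s, ~ q s /\ exists z, K z /\ J k0 (s * c + z).
    exact: not_all_ex_not hits.
  exists (maxn m k0) => k; rewrite geq_max => /andP[mk k0k] x [r Kr] Jx.
  apply: Hm => //; last exact: mono' (leq_maxl _ _) Jx.
  suff qr : q r by apply: ideal_subK Kr _ => //; apply: qc.
  apply: NNPP => nqr; apply: Hk0; exists r; split=> //; exists (x - r * c); split=> //.
  by rewrite addrC subrK; apply: mono' (leq_maxr _ _) Jx.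
Qed.

Definition proper_sub I J := (forall x, I x -> J x) /\ exists x, J x /\ ~ I x.

(* Krull's principal ideal theorem in contrapositive form: [q] is not minimal over
   [p + (a)].  For [x] in [p1] but not in [p], the chain of the ideals
   [J k = (x^k + p : a^oo)], localized at [q], is stationary because it is so modulo [a];
   this puts a power of [a] into [(x) + p]. *)
Lemma krull_principal p p1 q a : noetherian Q ->
  prime_ideal p -> prime_ideal p1 -> prime_ideal q ->
  proper_sub p p1 -> proper_sub p1 q -> q a -> ~ p1 a ->
  exists p', prime_ideal p' /\ p' a /\ proper_sub p p' /\ proper_sub p' q.
Proof.
move=> noeth pp pp1 pq [sub_p1 [x [p1x npx]]] [sub_q [u [qu np1u]]] qa np1a.
apply: NNPP => noprime.
have hp := proj1 pp; have hq := proj1 pq.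
have qmin p' : prime_ideal p' -> (forall z, adjoin p a z -> p' z) ->
    (forall z, p' z -> q z) -> forall z, q z -> p' z.
  move=> pp' H1 H2 z qz; apply: NNPP => np'z; apply: noprime; exists p'; split=> //.
  have p'a : p' a by apply: H1; apply: adjoin_mem1.
  split=> //; split; split=> //; last by exists z.
    by move=> w pw; apply/H1/sub_adjoin.
  by exists a; split=> // /sub_p1.
pose J k r := exists s e, ~ q s /\ adjoin p (x ^+ k) (s * a ^+ e * r).
have hJ k : is_ideal (J k).
  have hk := @adjoin_ideal p (x ^+ k) hp.
  split; first by exists 1, 0%N; rewrite mulr0; split; [case: pq => _ [] | exact: is_ideal0].
  split=> [y z [s [e [Hs Hy]]] [r [g [Hr Hz]]]|c y [s [e [Hs Hy]]]].
    exists (s * r), (e + g)%N; split; first exact: prime_mulN.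
    have -> : s * r * a ^+ (e + g) * (y + z) =
      r * a ^+ g * (s * a ^+ e * y) + s * a ^+ e * (r * a ^+ g * z) by rewrite exprD; ring.
    by apply: is_idealD => //; apply: is_idealMl.
  exists s, e; split=> //; have -> : s * a ^+ e * (c * y) = c * (s * a ^+ e * y) by ring.
  exact: is_idealMl.
have sJ k : saturated q (J k).
  move=> y [r [Hr [s [e [Hs H]]]]]; exists (s * r), e; split; first exact: prime_mulN.
  by have -> : s * r * a ^+ e * y = s * a ^+ e * (r * y) by ring.
have monoJ k y : J k.+1 y -> J k y.
  move=> [s [e [Hs [c H]]]]; exists s, e; split=> //; exists (c * x).
  by rewrite -(mulrA c) -exprS.
have pJ k y : p y -> J k y.
  move=> py; exists 1, 0%N; split; first by case: pq => _ [].
  by apply: sub_adjoin; apply: is_idealMl.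
have aJ k y : J k (a * y) -> J k y.
  move=> [s [e [Hs H]]]; exists s, e.+1; split=> //.
  by have -> : s * a ^+ e.+1 * y = s * a ^+ e * (a * y) by rewrite exprS; ring.
have [m Hm] : exists m, forall k, (m <= k)%N -> forall y,
    saturation q (adjoin (J m) a) y -> saturation q (adjoin (J k) a) y.
  apply: (@saturated_dcc q (adjoin p a) (fun k => saturation q (adjoin (J k) a))) => //.
  - by move=> k; apply/saturation_ideal/adjoin_ideal.
  - by move=> k; apply/saturation_saturated.
  - move=> k y [c py]; apply: sub_saturation => //; exists c; exact: pJ.
  - by move=> k y [s [Hs [c /monoJ H]]]; exists s; split=> //; exists c.
  - exact: adjoin_ideal.
(* [J m] is closed under division by a: if y is in [J m] and s y - c a is in [J m.+1], then c is in
   [J m]. Hence stationarity modulo a makes [J m] lie in J_(m+1) + q J_m locally, as Nakayama's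
   lemma requires. *)
have JS : forall y, J m y -> J m.+1 y.
  apply: (@nakayama q) => // K hK JK qJK y Jy.
  have [|s [Hs [c Hc]]] := Hm m.+1 (leqnSn m) y.
    by apply: sub_saturation => //; apply: sub_adjoin.
  exists s; split=> //; apply: ideal_subK (JK _ Hc) _ => //; rewrite mulrC; apply: qJK => //.
  apply: aJ; have -> : a * c = s * y - (s * y - c * a) by ring.
  by apply: is_idealB => //; [apply: is_idealMl | apply: monoJ].
(* For x^m the inclusion says that s a^e x^m lies in p + (x^(m+1)); cancelling x^m modulo p puts s
   a^e into p1, although neither s nor a is there. *)
have [|s [e [Hs [c Hc]]]] := JS (x ^+ m).
  exists 1, 0%N; split; [by case: pq => _ [] | exact: adjoin_mem].
have p1P := pp1.2.2; have hp1 := proj1 pp1.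
have : p (x ^+ m * (s * a ^+ e - c * x)).
  by have -> : x ^+ m * (s * a ^+ e - c * x) = s * a ^+ e * x ^+ m - c * x ^+ m.+1
    by rewrite exprS; ring.
case/(pp.2.2) => [|/sub_p1 H]; first exact: prime_expN.
have : p1 (s * a ^+ e) by apply: ideal_subK H _ => //; apply: is_idealMl.
case/p1P => [/sub_q //|]; exact: prime_expN.
Qed.

(** * Chains of primes *)

Fixpoint chain (d : nat) p q : Prop :=
  prime_ideal p /\
  if d is d'.+1 then exists r : Q -> Prop, proper_sub p r /\ chain d' r q else p = q.

Lemma chain_prime d p q : chain d p q -> prime_ideal p.
Proof. by case: d => [|d] []. Qed.

(** The element a is pushed down the chain: where it lies in a member but not in the one below,
    Krull's theorem replaces the latter by a prime containing a. *)
Lemma chain_shift d p q a : noetherian Q -> chain d.+1 p q -> q a ->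
  exists r : Q -> Prop, r a /\ proper_sub p r /\ chain d r q.
Proof.
move=> noeth Hc qa; elim: d p Hc => [|d IH] p.
  by move=> [_ [r [pr [prr rq]]]]; exists r; split; [rewrite rq | split].
move=> [pp [r [pr Hr]]]; case: (classic (r a)) => ra; first by exists r.
have [r' [r'a [rr' Hr']]] := IH r Hr.
have [p' [pp' [p'a [pp'1 pp'2]]]] := krull_principal noeth pp (proj1 Hr)
  (chain_prime Hr') pr rr' r'a ra.
by exists p'; split=> //; split=> //; split=> //; exists r'.
Qed.

(** * Regular sequences generating the maximal ideal *)

Section Local.
Variable n : Q -> Prop.
Hypotheses (noeth : noetherian Q) (loc : local_ring n).

Let hn : is_ideal n. Proof. by case: loc. Qed.

Lemma local_proper I : is_ideal I -> ~ I 1 -> forall x, I x -> n x.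
Proof.
move=> hI I1 x Ix; apply: NNPP => nx; apply: I1.
by have [y <-] := loc.2.2 x nx; apply: is_idealMr.
Qed.

Lemma local_prime : prime_ideal n.
Proof.
split=> //; split; first by case: loc => _ [].
move=> u v nuv; case: (classic (n u)) => nu; [by left | right].
have [y uy] := loc.2.2 u nu.
by rewrite -(mul1r v) -uy (mulrC u) -mulrA; apply: is_idealMl.
Qed.

Lemma local_saturated I : is_ideal I -> saturated n I.
Proof.
move=> hI x [s [/loc.2.2[y sy] Ix]].
by rewrite -(mul1r x) -sy (mulrC s) -mulrA; apply: is_idealMl.
Qed.

Lemma prime_sub_max p : prime_ideal p -> forall x, p x -> n x.
Proof. by move=> [hp [p1 _]]; apply: local_proper. Qed.

Lemma chain_top d p q : chain d.+1 p q -> chain d.+1 p n.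
Proof.
elim: d p => [|d IH] p [pp [r [[pr [x [rx npx]]] Hr]]].
  split=> //; exists n; split; last by split=> //; exact: local_prime.
  split; first exact: prime_sub_max.
  by exists x; split=> //; exact: prime_sub_max (proj1 Hr) _ rx.
by split=> //; exists r; split; [split=> //; exists x | apply: IH].
Qed.

Fixpoint extend I (g : seq Q) : Q -> Prop :=
  if g is a :: g' then extend (adjoin I a) g' else I.

(** Regularity on Q/I is phrased with ideals of Q, so that no quotient ring has to be formed. *)
Fixpoint regular_mod I (g : seq Q) : Prop :=
  if g is a :: g' then (forall x, I (a * x) -> I x) /\ regular_mod (adjoin I a) g'
  else True.

Lemma extend_ideal g I : is_ideal I -> is_ideal (extend I g).
Proof. by elim: g I => //= a g IH I hI; apply/IH/adjoin_ideal. Qed.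

Lemma extendS g I J : (forall x, I x -> J x) -> forall x, extend I g x -> extend J g x.
Proof.
elim: g I J => //= a g IH I J IJ; apply: IH => x; exact: adjoinS.
Qed.

Lemma sub_extend g I x : I x -> extend I g x.
Proof. by elim: g I => //= a g IH I Ix; apply/IH/sub_adjoin. Qed.

Lemma regular_modS g I J : (forall x, I x <-> J x) -> regular_mod I g -> regular_mod J g.
Proof.
elim: g I J => //= a g IH I J IJ [H1 H2]; split.
  by move=> x /IJ /H1 /IJ.
by apply: IH H2 => x; split; apply: adjoinS => y /IJ.
Qed.

Lemma extend_sub g I J : is_ideal J -> (forall x, I x -> J x) ->
  (forall a, a \in g -> J a) -> forall x, extend I g x -> J x.
Proof.
move=> hJ; elim: g I => //= a g IH I IJ gJ; apply: IH.
  by move=> y; apply: adjoin_sub => //; apply: gJ; rewrite mem_head.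
by move=> c cg; apply: gJ; rewrite inE cg orbT.
Qed.

Lemma mem_extend g I a : is_ideal I -> a \in g -> extend I g a.
Proof.
elim: g I => //= c g IH I hI; rewrite inE => /orP[/eqP->|ag].
  by apply/sub_extend/adjoin_mem1.
by apply: IH => //; apply: adjoin_ideal.
Qed.

(** An elementary form of the vanishing of Tor_1(Q/P, Q/(g)): the intersection of P with I + (g)
    lies in I + nP. The elements of g are peeled off one at a time; if x and x - c a lie in P, then
    so does c by regularity, and c a is in nP. *)
Lemma regular_extend_inter g I P : is_ideal I -> is_ideal P ->
  (forall x, I x -> P x) -> regular_mod P g -> (forall a, a \in g -> n a) ->
  forall K, is_ideal K -> (forall x, I x -> K x) ->
    (forall m x, n m -> P x -> K (m * x)) ->
  forall x, P x -> extend I g x -> K x.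
Proof.
move=> hI hP IP reg gn K hK IK nPK.
(* One may assume [K] contained in [P], on intersecting the two. *)
suff gen g' I' P' K' : is_ideal I' -> is_ideal P' -> (forall x, I' x -> P' x) ->
    regular_mod P' g' -> (forall a, a \in g' -> n a) -> is_ideal K' ->
    (forall x, I' x -> K' x) -> (forall x, K' x -> P' x) ->
    (forall m x, n m -> P' x -> K' (m * x)) -> forall x, P' x -> extend I' g' x -> K' x.
  move=> x Px Ex; suff: K x /\ P x by case.
  apply: (gen g I P (fun x => K x /\ P x)) => //.
  - split; first by split; apply: is_ideal0.
    split=> [y z [? ?] [? ?]|r y [? ?]]; first by split; apply: is_idealD.
    by split; apply: is_idealMl.
  - by move=> y Iy; split; [apply: IK | apply: IP].
  - by move=> y [].
  - by move=> m y nm Py; split; [apply: nPK | apply: is_idealMl].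
elim: g' I' P' K' => [|a g' IH] I' P' K' hI' hP' IP' /= reg' gn' hK' IK' KP' nPK' x P'x.
  exact: IK'.
case: reg' => rega reg' Ex.
have na : n a by apply: gn'; rewrite mem_head.
have [|||||c Hc] := IH (adjoin I' a) (adjoin P' a) (adjoin K' a)
    (@adjoin_ideal _ a hI') (@adjoin_ideal _ a hP') _ reg' _ (@adjoin_ideal _ a hK')
    _ _ _ x (@sub_adjoin _ a _ P'x) Ex.
- by move=> y; apply: adjoinS.
- by move=> y yg; apply: gn'; rewrite inE yg orbT.
- by move=> y; apply: adjoinS.
- by move=> y; apply: adjoinS.
- move=> m y nm [r Hr]; exists (m * r); rewrite -mulrA -mulrBr; exact: nPK'.
apply: ideal_subK (Hc) _ => //; rewrite mulrC; apply: nPK' => //; apply: rega.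
have -> : a * c = x - (x - c * a) by ring.
by apply: is_idealB => //; apply: KP'.
Qed.

(** As I + (g) is all of n, it contains P; hence P lies in I + nP, and Nakayama's lemma applies. *)
Lemma regular_extend_eq g I P : is_ideal I -> is_ideal P -> (forall x, P x -> n x) ->
  (forall x, I x -> P x) -> regular_mod P g -> (forall x, n x <-> extend I g x) ->
  forall x, P x -> I x.
Proof.
move=> hI hP Pn IP reg nE; apply: (nakayama noeth local_prime hI (local_saturated hI)).
move=> K hK IK nPK x Px; apply: sub_saturation; first exact: local_prime.
apply: (@regular_extend_inter g I P) => //; last by apply/nE/Pn.
by move=> a ag; apply/nE; apply: mem_extend.
Qed.

(** If the first element a were in p, the remaining ones, fewer than d, would generate n modulo p,
    against the induction hypothesis. Otherwise the chain shifts to a prime r containing a; by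
    induction the rest of g is regular modulo r, and this forces r = p + (a). *)
Lemma chain_regular (g : seq Q) d p q : chain d p q ->
  (forall x, n x <-> extend p g x) -> (size g <= d)%N ->
  size g = d /\ regular_mod p g.
Proof.
elim: g d p q => [|a g IH] d p q Hc /= nE gd.
  split=> //; case: d Hc gd => // d [_ [r [[_ [x [rx npx]]] Hr]]] _.
  by case: npx; apply/nE; apply: prime_sub_max (chain_prime Hr) _ rx.
have pp := chain_prime Hc; have hp := proj1 pp.
case: (classic (p a)) => pa.
  have [||gd' _] := IH d p q Hc; last by rewrite gd' ltnn in gd.
  - move=> x; split; last by move=> Ex; apply/nE; apply: extendS Ex => y; exact: sub_adjoin.
    by move=> /nE; apply: extendS => y; apply: adjoin_sub.
  - exact: ltnW.
case: d Hc gd => // d Hc gd.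
have na : n a by apply/nE/sub_extend/adjoin_mem1.
have [r [ra [[pr pr'] Hr]]] := chain_shift noeth (chain_top Hc) na.
have prr := chain_prime Hr; have hr := proj1 prr.
have adjr : forall x, adjoin p a x -> r x by move=> x; apply: adjoin_sub.
have hadj := @adjoin_ideal p a hp.
have [|gd' reg] := IH d r n Hr _ gd.
  move=> x; split; first by move=> /nE; apply: extendS.
  apply: extend_sub => //; first exact: prime_sub_max.
  by move=> c cg; apply/nE/mem_extend.
split; first by rewrite gd'.
split; first by move=> x /(pp.2.2) [].
apply: regular_modS (reg) => x; split=> //; last exact: adjr.
apply: (@regular_extend_eq g (adjoin p a) r) => //; exact: prime_sub_max.
Qed.

Lemma gen_ideal_extend (g : seq Q) I x : is_ideal I -> gen_ideal g x -> extend I g x.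
Proof.
move=> hI; apply: gen_ideal_sub; first exact: extend_ideal.
by move=> j jg; apply: mem_extend => //; apply: mem_nth.
Qed.

(* Krull's theorem forces [g] to be regular modulo the bottom prime [P 0] of a chain of
   length [size g], and regularity then forces [P 0 = 0]. *)
Lemma regular_local_seq d : has_prime_chain Q d -> min_num_gens n d ->
  exists g, regular_mod (fun x => x = 0) g /\
    forall x, n x <-> extend (fun x => x = 0) g x.
Proof.
move=> [P [pP sP]] [[g [gd nE]] _]; exists g.
have h0 : is_ideal (fun x : Q => x = 0).
  by split=> //; split=> [x y -> ->|r x ->]; rewrite ?addr0 ?mulr0.
have gn a : a \in g -> n a.
  by move=> ag; apply/nE; rewrite -(nth_index 0 ag); apply: gen_ideal_nth; rewrite index_mem.
have nE' I : is_ideal I -> (forall x, I x -> n x) -> forall x, n x <-> extend I g x.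
  move=> hI In x; split; last exact: extend_sub.
  by move=> /nE; apply: gen_ideal_extend.
have n0 x : x = 0 -> n x by move=> ->; apply: is_ideal0.
have Hc : chain d (P 0%N) (P d).
  have: forall k i, (i + k = d)%N -> chain k (P i) (P d).
    elim=> [|k IH] i ik; first by rewrite addn0 in ik; split; [apply: pP; rewrite ik | rewrite ik].
    split; first by apply: pP; rewrite -ik leq_addr.
    exists (P i.+1); split; last by apply: IH; rewrite addSnnS.
    by apply: sP; rewrite -ik -addSnnS leq_addr.
  exact.
have pP0 := chain_prime Hc; have hP0 := proj1 pP0; have Pn := prime_sub_max pP0.
have [|_ reg] := chain_regular Hc (nE' _ hP0 Pn); first by rewrite gd.
split; last exact: nE'.
apply: regular_modS (reg) => x; split; last by move=> ->; apply: is_ideal0.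
by apply: (@regular_extend_eq g (fun x => x = 0) (P 0%N)) => // [y ->|];
  [apply: is_ideal0 | apply: nE'].
Qed.

End Local.
End Ideals.

(** * Orders and regular sequences *)

Section Powers.
Variables (Q : comNzRingType) (n : Q -> Prop).
Hypothesis hn : is_ideal n.

Lemma ideal_pow_ideal k : is_ideal (ideal_pow n k).
Proof.
case: k => [|k] //; split; first by exists [::]; rewrite big_nil.
split=> [x y [s [Hs ->]] [s' [Hs' ->]]|r x [s [Hs ->]]].
  exists (s ++ s'); rewrite big_cat; split=> // p.
  by rewrite mem_cat => /orP[/Hs|/Hs'].
exists [seq (r * p.1, p.2) | p <- s]; split.
  by move=> _ /mapP[p /Hs[H1 H2] ->]; split=> //; apply: is_idealMl.
by rewrite big_map mulr_sumr; apply: eq_bigr => p _; rewrite mulrA.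
Qed.

Lemma ideal_powS k x : ideal_pow n k.+1 x -> ideal_pow n k x.
Proof.
have hk := ideal_pow_ideal k; move=> [s [Hs ->]].
by apply: ideal_sum_seq => // p /Hs[_ H]; apply: is_idealMl.
Qed.

Lemma ideal_pow_le k l x : (l <= k)%N -> ideal_pow n k x -> ideal_pow n l x.
Proof. by move=> /subnK <-; elim: (k - l)%N => // i IH /ideal_powS. Qed.

Lemma ideal_pow_mul k l x y :
  ideal_pow n k x -> ideal_pow n l y -> ideal_pow n (k + l) (x * y).
Proof.
have hP i := ideal_pow_ideal i.
elim: k x => [|k IH] x; first by move=> _ Hy; apply: is_idealMl.
move=> [s [Hs ->]] Hy; rewrite addSn mulr_suml.
apply: ideal_sum_seq; first exact: (hP (k + l).+1).
move=> p /Hs[H1 H2].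
exists [:: (p.1, p.2 * y)]; rewrite big_seq1 mulrA; split=> // q.
by rewrite inE => /eqP ->; split=> //; apply: IH.
Qed.

Lemma ideal_powS_sub k x : ideal_pow n k.+1 x -> n x.
Proof. by move=> [s [Hs ->]]; apply: ideal_sum_seq => // p /Hs[H _]; apply: is_idealMr. Qed.

Lemma ideal_pow1 x : n x -> ideal_pow n 1 x.
Proof.
by move=> nx; exists [:: (x, 1)]; rewrite big_seq1 mulr1; split=> // p; rewrite inE => /eqP ->.
Qed.

(** This is the equality of (f) and n^K intersected with sum_j f_j n^(K - e_j). The order of the
    last coefficient is raised one step at a time: while s + e_i < K, the product of f_i with it has
    its degree s + e_i form in the ideal of the earlier initial forms, hence so has the coefficient
    its degree s form, and a Koszul relation moves it into n^(s+1). *)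
Lemma gr_regular_inter (f : seq Q) (e : seq nat) :
  gr_regular_seq n f e ->
  (forall j, (j < size f)%N -> ideal_pow n (nth 0%N e j) (nth 0 f j)) ->
  forall i K (a : nat -> Q), (i <= size f)%N ->
  ideal_pow n K (\sum_(j < i) nth 0 f j * a j) ->
  exists a' : nat -> Q, (forall j, (j < i)%N -> ideal_pow n (K - nth 0%N e j) (a' j)) /\
    \sum_(j < i) nth 0 f j * a j = \sum_(j < i) nth 0 f j * a' j.
Proof.
move=> reg fe; have hP k := ideal_pow_ideal k.
elim=> [|i IH] K a isz Hx; first by exists a; rewrite !big_ord0.
set x := \sum_(j < i.+1) _ in Hx *.
set ei := nth 0%N e i.
have improve s : (s <= K - ei)%N -> exists a' : nat -> Q,
    x = \sum_(j < i.+1) nth 0 f j * a' j /\ ideal_pow n s (a' i).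
  elim: s => [|s IHs] sK; first by exists a.
  have [a' [xE Ha']] := IHs (ltnW sK).
  have Hfa : ideal_pow n (s + ei) (nth 0 f i * a' i).
    by rewrite addnC; apply: ideal_pow_mul => //; apply: fe.
  have seK : (s + ei < K)%N by rewrite addnC -ltn_subRL.
  move: xE; rewrite big_ord_recr /= => xE.
  have [|a2 [Ha2 sumE]] := IH (s + ei)%N a' (ltnW isz).
    have -> : \sum_(j < i) nth 0 f j * a' j = x - nth 0 f i * a' i by rewrite xE addrK.
    by apply: is_idealB => //; apply: ideal_pow_le Hx; apply: ltnW.
  have [y [Hy Hr]] : gr_in n f e i s (a' i).
    apply: reg => //; change (gr_in n f e i (s + ei) (nth 0 f i * a' i)).
    (* [gr_in] demands the coefficient 0 when e_j > s + e_i; the omitted terms lie in n^(s+e_i+1)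
       because f_j is in n^(e_j). *)
    exists (fun j => if (nth 0%N e j <= s + ei)%N then - a2 j else 0); split.
      move=> j ji; change (if (nth 0%N e j <= s + ei)%N then ideal_pow n (s + ei - nth 0%N e j)
        (if (nth 0%N e j <= s + ei)%N then - a2 j else 0)
        else (if (nth 0%N e j <= s + ei)%N then - a2 j else 0) = 0).
      by case: ifP => -> //; exact: (is_idealN (hP _) (Ha2 j ji)).
    have -> : nth 0 f i * a' i - \sum_(j < i) nth 0 f j *
        (if (nth 0%N e j <= s + ei)%N then - a2 j else 0) =
        x - \sum_(j < i) nth 0 f j * (if (nth 0%N e j <= s + ei)%N then 0 else a2 j).
      rewrite xE sumE; set s1 := \sum_(j < i) nth 0 f j * (if _ then - _ else 0).
      set s2 := \sum_(j < i) nth 0 f j * (if _ then 0 else _).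
      suff -> : \sum_(j < i) nth 0 f j * a2 j = s2 - s1 by ring.
      rewrite -sumrB; apply: eq_bigr => j _; rewrite -mulrBr; congr (_ * _).
      by case: ifP => _; rewrite ?sub0r ?opprK ?subr0.
    apply: is_idealB => //; first exact: ideal_pow_le Hx.
    apply: ideal_sum => // j _; case: ifP => [_|/negbT]; first by rewrite mulr0; apply: is_ideal0.
    rewrite -ltnNge => sej; apply: is_idealMr => //; apply: ideal_pow_le sej _.
    by apply: fe; apply: ltn_trans isz.
  (* Adding Koszul relations between f_i and the earlier f_j leaves the sum unchanged. *)
  exists (fun j => if (j < i)%N then a' j + nth 0 f i * y j
                   else a' i - \sum_(l < i) nth 0 f l * y l); rewrite ltnn; split=> //.
  rewrite big_ord_recr /= ltnn xE.
  under [X in _ = X + _]eq_bigr => j _ do rewrite ltn_ord mulrDr mulrCA.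
  by rewrite big_split /= -mulr_sumr mulrBr -addrA (addrCA (_ * _)) subrr addr0.
have [a1 [xE Ha1]] := improve _ (leqnn _).
move: xE; rewrite big_ord_recr /= => xE.
have [|a2 [Ha2 sumE]] := IH K a1 (ltnW isz).
  have -> : \sum_(j < i) nth 0 f j * a1 j = x - nth 0 f i * a1 i by rewrite xE addrK.
  apply: is_idealB => //; apply: (@ideal_pow_le (ei + (K - ei))); first by rewrite -leq_subLR.
  by apply: ideal_pow_mul => //; apply: fe.
exists (fun j => if (j < i)%N then a2 j else a1 i); split.
  by move=> j; rewrite ltnS leq_eqVlt => /orP[/eqP->|ji]; [rewrite ltnn | rewrite ji; apply: Ha2].
rewrite big_ord_recr /= ltnn xE sumE; congr (_ + _).
by apply: eq_bigr => j _; rewrite ltn_ord.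
Qed.

End Powers.

Section RegularSequence.
Variables (Q : comNzRingType) (f : seq Q).

Lemma gen_ideal_take i x : (i <= size f)%N ->
  gen_ideal (take i f) x <-> exists r : nat -> Q, x = \sum_(j < i) nth 0 f j * r j.
Proof.
move=> isz; rewrite /gen_ideal size_takel //.
by split=> -[r ->]; exists r; apply: eq_bigr => j _; rewrite nth_take // mulrC.
Qed.

Lemma gen_ideal_takeS i x : (i < size f)%N -> gen_ideal (take i f) x ->
  gen_ideal (take i.+1 f) x.
Proof.
move=> isz /(gen_ideal_take _ (ltnW isz))[r ->]; apply/gen_ideal_take => //.
exists (fun j => if (j < i)%N then r j else 0).
rewrite big_ord_recr /= ltnn mulr0 addr0.
by apply: eq_bigr => j _; rewrite ltn_ord.
Qed.

Hypothesis reg : forall i, (i < size f)%N -> forall x,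
  gen_ideal (take i f) (nth 0 f i * x) -> gen_ideal (take i f) x.

(** Regularity writes the last coefficient as a combination of the earlier f_j with coefficients
    c_j; substituting it leaves a shorter relation with coefficients a_j + f_i c_j. *)
Lemma regular_syzygy i (a : nat -> Q) : (i <= size f)%N ->
  \sum_(j < i) nth 0 f j * a j = 0 ->
  forall j, (j < i)%N -> gen_ideal (take i f) (a j).
Proof.
elim: i a => [|i IH] a isz //; rewrite big_ord_recr /= => sum0.
have hI := gen_ideal_ideal (take i f).
have Hai : gen_ideal (take i f) (a i).
  apply: reg => //; rewrite -(addKr (\sum_(j < i) nth 0 f j * a j) (_ * _)) sum0 addr0.
  by apply: is_idealN => //; apply/gen_ideal_take; [apply: ltnW | exists a].
have /gen_ideal_take [|c aE] := Hai; first exact: ltnW.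
have sum0' : \sum_(j < i) nth 0 f j * (a j + nth 0 f i * c j) = 0.
  apply: etrans sum0; rewrite aE mulr_sumr -big_split; apply: eq_bigr => j _.
  by rewrite mulrDr mulrCA.
move=> j; rewrite ltnS leq_eqVlt => /orP[/eqP->|ji]; first exact: gen_ideal_takeS.
have := gen_ideal_takeS isz (IH (fun j => a j + nth 0 f i * c j) (ltnW isz) sum0' j ji).
rewrite -{2}[a j](addrK (nth 0 f i * c j)) => H.
apply: is_idealB => //; first exact: gen_ideal_ideal.
apply: is_idealMr; first exact: gen_ideal_ideal.
have -> : nth 0 f i = nth 0 (take i.+1 f) i by rewrite nth_take.
by apply: gen_ideal_nth; rewrite size_takel.
Qed.

End RegularSequence.

(** * Matrices modulo an ideal *)

Section MatrixIdeal.
Variables (Q : comNzRingType).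

Definition mx_in (I : Q -> Prop) m p (M : 'M[Q]_(m, p)) := forall r s, I (M r s).

Section Closure.
Variables (I : Q -> Prop) (hI : is_ideal I).

Lemma mx_in0 m p : mx_in I (0 : 'M_(m, p)).
Proof. by move=> r s; rewrite mxE; apply: is_ideal0. Qed.
Lemma mx_inD m p (M N : 'M_(m, p)) : mx_in I M -> mx_in I N -> mx_in I (M + N).
Proof. by move=> HM HN r s; rewrite mxE; apply: is_idealD. Qed.
Lemma mx_inN m p (M : 'M_(m, p)) : mx_in I M -> mx_in I (- M).
Proof. by move=> HM r s; rewrite mxE; apply: is_idealN. Qed.
Lemma mx_inB m p (M N : 'M_(m, p)) : mx_in I M -> mx_in I N -> mx_in I (M - N).
Proof. by move=> HM HN; apply: mx_inD => //; apply: mx_inN. Qed.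
Lemma mx_inZ m p a (M : 'M_(m, p)) : mx_in I M -> mx_in I (a *: M).
Proof. by move=> HM r s; rewrite mxE; apply: is_idealMl. Qed.
Lemma mx_inZl m p a (M : 'M_(m, p)) : I a -> mx_in I (a *: M).
Proof. by move=> Ia r s; rewrite mxE; apply: is_idealMr. Qed.
Lemma mx_inMl m p q (N : 'M_(m, p)) (M : 'M_(p, q)) : mx_in I M -> mx_in I (N *m M).
Proof. by move=> HM r s; rewrite mxE; apply: ideal_sum => // k _; apply: is_idealMl. Qed.
Lemma mx_inMr m p q (M : 'M_(m, p)) (N : 'M_(p, q)) : mx_in I M -> mx_in I (M *m N).
Proof. by move=> HM r s; rewrite mxE; apply: ideal_sum => // k _; apply: is_idealMr. Qed.
Lemma mx_in_sum m p (T : Type) (s : seq T) (A : pred T) (F : T -> 'M_(m, p)) :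
  (forall i, A i -> mx_in I (F i)) -> mx_in I (\sum_(i <- s | A i) F i).
Proof.
move=> HF; elim/big_ind: _ => //; first exact: mx_in0.
by move=> x y; apply: mx_inD.
Qed.
Lemma mx_in_subK m p (M N : 'M_(m, p)) : mx_in I (M - N) -> mx_in I N -> mx_in I M.
Proof. by move=> h1 h2; rewrite -(subrK N M); apply: mx_inD. Qed.
End Closure.

Lemma mx_in_sub (I J : Q -> Prop) m p (M : 'M_(m, p)) :
  (forall x, I x -> J x) -> mx_in I M -> mx_in J M.
Proof. by move=> IJ HM r s; apply: IJ. Qed.

Lemma mx_in_row (I : Q -> Prop) m p1 p2 (M : 'M_(m, p1)) (N : 'M_(m, p2)) :
  mx_in I (row_mx M N) <-> mx_in I M /\ mx_in I N.
Proof.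
split=> [H|[HM HN] r s].
  split=> r s; first by have := H r (lshift _ s); rewrite row_mxEl.
  by have := H r (rshift _ s); rewrite row_mxEr.
by case: (split_ordP s) => k ->; rewrite ?row_mxEl ?row_mxEr.
Qed.

Lemma mx_in_col (I : Q -> Prop) m1 m2 p (M : 'M_(m1, p)) (N : 'M_(m2, p)) :
  mx_in I (col_mx M N) <-> mx_in I M /\ mx_in I N.
Proof.
split=> [H|[HM HN] r s].
  split=> r s; first by have := H (lshift _ r) s; rewrite col_mxEu.
  by have := H (rshift _ r) s; rewrite col_mxEd.
by case: (split_ordP r) => k ->; rewrite ?col_mxEu ?col_mxEd.
Qed.

Lemma mx_choice (T : Type) m p (P : 'I_m -> 'I_p -> T -> Prop) :
  (forall r s, exists c, P r s c) -> exists c, forall r s, P r s (c r s).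
Proof.
move=> H; have H' r : exists c : 'I_p -> T, forall s, P r s (c s).
  exact: dependent_choice (H r).
by have [c Hc] := dependent_choice H'; exists c.
Qed.

Lemma mx_in_adjoin (I : Q -> Prop) a m p (M : 'M_(m, p)) :
  mx_in (adjoin I a) M -> exists C, mx_in I (M - a *: C).
Proof.
move=> /mx_choice[c Hc]; exists (\matrix_(r, s) c r s) => r s.
by rewrite !mxE mulrC.
Qed.

Variable f : seq Q.

Lemma mx_in_take j m p (M : 'M_(m, p)) : (j <= size f)%N ->
  mx_in (gen_ideal (take j f)) M ->
  exists U : nat -> 'M_(m, p), M = \sum_(l < j) nth 0 f l *: U l.
Proof.
move=> jsz HM.
have [r s|c Hc] := @mx_choice (nat -> Q) m p
    (fun r s c => M r s = \sum_(l < j) nth 0 f l * c l).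
  exact/gen_ideal_take.
exists (fun l => \matrix_(r, s) c r s l); apply/matrixP => r s.
by rewrite summxE Hc; apply: eq_bigr => l _; rewrite !mxE.
Qed.

Lemma mx_in_takeS j m p (M : 'M_(m, p)) : (j < size f)%N ->
  mx_in (gen_ideal (take j.+1 f)) M ->
  exists U : 'M_(m, p), mx_in (gen_ideal (take j f)) (M - nth 0 f j *: U).
Proof.
move=> jsz /(mx_in_take jsz)[U ->]; exists (U j).
rewrite big_ord_recr /= addrK => r s; rewrite summxE.
apply/gen_ideal_take; first exact: ltnW.
by exists (fun l => U l r s); apply: eq_bigr => l _; rewrite mxE.
Qed.

Hypothesis reg : forall i, (i < size f)%N -> forall x,
  gen_ideal (take i f) (nth 0 f i * x) -> gen_ideal (take i f) x.

Lemma mx_regular j m p (M : 'M_(m, p)) : (j < size f)%N ->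
  mx_in (gen_ideal (take j f)) (nth 0 f j *: M) -> mx_in (gen_ideal (take j f)) M.
Proof. by move=> jsz HM r s; apply: reg => //; have := HM r s; rewrite mxE. Qed.

Lemma mx_syzygy j m p (M : nat -> 'M_(m, p)) : (j <= size f)%N ->
  \sum_(l < j) nth 0 f l *: M l = 0 ->
  forall l, (l < j)%N -> mx_in (gen_ideal (take j f)) (M l).
Proof.
move=> jsz sum0 l lj r s; apply: (regular_syzygy reg (a := fun l => M l r s)) => //.
have := congr1 (fun X : 'M_(m, p) => X r s) sum0; rewrite summxE mxE; apply: etrans.
by apply: eq_bigr => i _; rewrite mxE.
Qed.

End MatrixIdeal.

(** * Linear algebra over the residue field and chains of submodules of free modules *)

Section LocalDuality.
Variables (Q : comNzRingType) (n : Q -> Prop).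
Hypothesis loc : local_ring n.

(* Over the residue field, a functional vanishing on the kernel of [M] factors through [M]. *)
Lemma factor_through_kernel m p (M : 'M[Q]_(m, p)) (phi : 'rV_p) :
  (forall v : 'cV_p, mx_in n (M *m v) -> mx_in n (phi *m v)) ->
  exists psi : 'rV_m, mx_in n (phi - psi *m M).
Proof.
have hn : is_ideal n by case: loc.
elim: m M phi => [|m IH].
  move=> M phi Hphi; exists 0; rewrite mul0mx subr0 => r s.
  have Hs : mx_in n (phi *m delta_mx s (0 : 'I_1)) by apply: Hphi => -[].
  by have := Hs r 0; rewrite -colE mxE.
rewrite -[m.+1]/(1 + m)%N => M phi; rewrite -[M]vsubmxK.
set x := usubmx _; set M' := dsubmx _ => Hphi.
have scal (u : 'rV_p) (v : 'cV_p) : mx_in n (u *m v) <-> n ((u *m v) 0 0).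
  by split=> [H|H r s]; [exact: H | rewrite !ord1].
have entryB (u v : 'M[Q]_1) : (u - v) 0 0 = u 0 0 - v 0 0 by rewrite !mxE.
have entryZ a (u : 'M[Q]_1) : (a *: u) 0 0 = a * u 0 0 by rewrite !mxE.
(* If the top row x is a unit on some v in the kernel of the other rows, a multiple of x is
   subtracted from [phi] so that it vanishes on v. Otherwise the kernel of the other rows is the
   whole kernel. *)
case: (classic (exists v : 'cV_p, mx_in n (M' *m v) /\ ~ n ((x *m v) 0 0))) => [[v [M'v xv]]|nov].
- have [y xvy] := loc.2.2 _ xv.
  pose c := (phi *m v) 0 0 * y.
  have [|psi Hpsi] := IH M' (phi - c *: x).
    move=> w M'w; apply/scal.
    have /scal : mx_in n (phi *m (w - ((x *m w) 0 0 * y) *: v)).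
      apply: Hphi; rewrite mul_col_mx; apply/mx_in_col; split; last first.
        by rewrite mulmxBr -scalemxAr; apply: mx_inB => //; apply: mx_inZ.
      apply/scal; rewrite mulmxBr -scalemxAr entryB entryZ -mulrA (mulrC y) xvy.
      by rewrite mulr1 subrr; apply: is_ideal0.
    rewrite mulmxBr mulmxBl -scalemxAl -scalemxAr !entryB !entryZ /c.
    by congr (n _); ring.
  exists (row_mx c%:M psi); rewrite mul_row_col mul_scalar_mx opprD addrA.
  exact: Hpsi.
- have [|psi Hpsi] := IH M' phi.
    move=> v M'v; apply: Hphi; rewrite mul_col_mx; apply/mx_in_col; split=> //.
    by apply/scal; apply: NNPP => nxv; apply: nov; exists v.
  by exists (row_mx 0 psi); rewrite mul_row_col mul0mx add0r.
Qed.

End LocalDuality.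

(** Induction on the rank: the ideals of first entries and the submodules of vectors with first
    entry 0 both stabilize. *)
Lemma noetherian_rV (Q : comNzRingType) m (S : nat -> 'rV[Q]_m -> Prop) :
  noetherian Q -> (forall k, S k 0) ->
  (forall k x y, S k x -> S k y -> S k (x + y)) ->
  (forall k a x, S k x -> S k (a *: x)) ->
  (forall k x, S k x -> S k.+1 x) ->
  exists l, forall k x, S k x -> S l x.
Proof.
move=> noeth; elim: m S => [|m IH].
  by move=> S S0 _ _ _; exists 0%N => k x _; rewrite (thinmx0 x).
rewrite -[m.+1]/(1 + m)%N => S S0 SD SZ mono.
have mono' k k' x : (k <= k')%N -> S k x -> S k' x.
  by move=> /subnK <-; elim: (k' - k)%N => // i IHi Sx; apply/mono/IHi.
have [||l1 Hl1] := @noetherian_acc _ noeth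
    (fun k a => exists v : 'rV_m, S k (row_mx (a%:M : 'M_1) v)).
- move=> k; split; first by exists 0; rewrite raddf0 row_mx0; apply: S0.
  split=> [a c [v Sv] [w Sw]|a c [v Sv]].
    by exists (v + w); rewrite raddfD -add_row_mx; apply: (SD).
  by exists (a *: v); rewrite -scale_scalar_mx -scale_row_mx; apply: (SZ).
- by move=> k a [v Sv]; exists v; apply: mono.
have [||||l2 Hl2] := IH (fun k (v : 'rV_m) => S k (row_mx (0 : 'M_1) v)).
- by move=> k; rewrite row_mx0.
- by move=> k x y Sx Sy; rewrite -[0]addr0 -add_row_mx; apply: (SD).
- by move=> k a x Sx; rewrite -[0](scaler0 _ a) -scale_row_mx; apply: (SZ).
- by move=> k x; apply: mono.
exists (maxn l1 l2) => k x; rewrite -(@hsubmxK _ 1 1 m x) [lsubmx x]mx11_scalar.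
set a := lsubmx x 0 0; set v := rsubmx _ => Sx.
have [|w Sw] := Hl1 k a; first by exists v.
have -> : row_mx a%:M v = row_mx a%:M w + row_mx 0 (v - w).
  by rewrite add_row_mx addr0 addrC subrK.
apply: (SD); first exact: (mono') (leq_maxl _ _) Sw.
apply: (mono') (leq_maxr _ _) _; apply: (Hl2 (maxn k l1)).
have -> : row_mx 0 (v - w) = row_mx a%:M v + (-1) *: row_mx a%:M w.
  by rewrite scaleN1r opp_row_mx add_row_mx subrr.
apply: (SD); first exact: (mono') (leq_maxl _ _) Sx.
by apply: (SZ); apply: (mono') (leq_maxr _ _) Sw.
Qed.

(** * The ascending chain condition for graded modules with operators *)

Section OperatorModule.
Variables (Q : comNzRingType) (b : nat -> nat).
Definition row_family := forall i, 'rV[Q]_(b i) -> Prop.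
Variables (Z B : row_family) (t : nat -> forall i, 'M[Q]_(b i, b i.+2)).
Implicit Types S L : row_family.

Definition linear_family S :=
  [/\ forall i, S i 0, forall i x y, S i x -> S i y -> S i (x + y)
    & forall i a x, S i x -> S i (a *: x)].

Definition sub_family S L := forall i x, S i x -> L i x.

(* Submodules of the graded module [Z / B] over [Q[t 0, ..., t (j - 1)]]. *)
Definition submodule j S :=
  [/\ linear_family S, sub_family B S, sub_family S Z &
      forall l, (l < j)%N -> forall i x, S i x -> S i.+2 (x *m t l i)].

Definition noetherian_module j := forall S : nat -> row_family,
  (forall k, submodule j (S k)) -> (forall k, sub_family (S k) (S k.+1)) ->
  exists m, forall k, sub_family (S k) (S m).

Lemma linear_familyN S i x : linear_family S -> S i x -> S i (- x).
Proof. by move=> [_ _ SZ] Sx; rewrite -scaleN1r; apply: SZ. Qed.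

Lemma linear_familyB S i x y : linear_family S -> S i x -> S i y -> S i (x - y).
Proof.
by move=> linS Sx Sy; have [_ SD _] := linS; apply: SD => //; apply: linear_familyN.
Qed.

Lemma family_le (S : nat -> row_family) k l : (forall k, sub_family (S k) (S k.+1)) ->
  (k <= l)%N -> sub_family (S k) (S l).
Proof.
by move=> mono /subnK <- i x; elim: (l - k)%N => // p IH Sx; apply/mono/IH.
Qed.

Section HilbertBasis.
Variable j : nat.
Hypotheses (linZ : linear_family Z) (BZ : sub_family B Z).
Hypothesis tZ : forall l, (l <= j)%N -> forall i x, Z x -> Z (x *m t l i).
Hypothesis tC : forall l, (l <= j)%N -> forall i x, Z x ->
  B (x *m t l i *m t j i.+2 - x *m t j i *m t l i.+2).
(** Chains of submodules containing the image of [t j] are chains in its cokernel. *)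
Hypothesis quotient_noetherian : forall L : nat -> row_family,
  (forall k, submodule j (L k)) -> (forall k, sub_family (L k) (L k.+1)) ->
  (forall k i x, Z x -> L k i.+2 (x *m t j i)) ->
  exists m, forall k, sub_family (L k) (L m).

Definition colon S : row_family := fun i x => Z x /\ S i.+2 (x *m t j i).

Definition image_op : row_family := fun i =>
  if i is i'.+2 then fun x => exists y, Z y /\ x = y *m t j i' else fun x => x = 0.

Definition add_image S : row_family := fun i x => exists s, S i s /\ image_op (x - s).

Lemma submodule_colon S : submodule j.+1 S -> submodule j.+1 (colon S).
Proof.
move=> [linS BS SZ Sop]; have [S0 SD SS] := linS; have [Z0 ZD ZS] := linZ.
split.
- split=> [i|i x y [Zx Sx] [Zy Sy]|i a x [Zx Sx]].
  + by split; rewrite ?mul0mx.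
  + by split; [apply: ZD | rewrite mulmxDl; apply: SD].
  + by split; [apply: ZS | rewrite -scalemxAl; apply: SS].
- by move=> i x Bx; split; [apply: BZ | apply: Sop => //; apply: BS].
- by move=> i x [].
- move=> l lj i x [Zx Sx]; split; first exact: tZ.
  rewrite -[_ *m _](subrK (x *m t j i *m t l i.+2)).
  by apply: SD; [apply/BS/tC | apply: Sop].
Qed.

Lemma sub_colon S : submodule j.+1 S -> sub_family S (colon S).
Proof. by move=> [_ _ SZ Sop] i x Sx; split; [apply: SZ | apply: Sop]. Qed.

Lemma colonS S S' : sub_family S S' -> sub_family (colon S) (colon S').
Proof. by move=> SS' i x [Zx /SS' Sx]. Qed.

Lemma add_imageS S S' : sub_family S S' -> sub_family (add_image S) (add_image S').
Proof. by move=> SS' i x [s [/SS' Ss H]]; exists s. Qed.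

Lemma linear_image : linear_family image_op.
Proof.
have [Z0 ZD ZS] := linZ; split.
- by case=> [|[|i]] //=; exists 0; rewrite mul0mx.
- case=> [|[|i]] x y /=; [by move=> -> ->; rewrite addr0 | by move=> -> ->; rewrite addr0 |].
  by move=> [u [Zu ->]] [v [Zv ->]]; exists (u + v); rewrite mulmxDl; split=> //; apply: ZD.
- case=> [|[|i]] a x /=; [by move=> ->; rewrite scaler0 | by move=> ->; rewrite scaler0 |].
  by move=> [u [Zu ->]]; exists (a *: u); rewrite -scalemxAl; split=> //; apply: ZS.
Qed.

Lemma image_sub : sub_family image_op Z.
Proof.
have [Z0 _ _] := linZ.
by case=> [|[|i]] x /=; [move=> -> | move=> -> | move=> [y [Zy ->]]; apply: tZ].
Qed.

Lemma submodule_add_image S : submodule j.+1 S -> submodule j (add_image S).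
Proof.
move=> [linS BS SZ Sop]; have [S0 SD SS] := linS; have [Z0 ZD ZS] := linZ.
have [I0 ID IS] := linear_image.
have sub_add : sub_family S (add_image S) by move=> i x Sx; exists x; rewrite subrr.
split.
- split=> [i|i x y [s [Ss Hs]] [u [Su Hu]]|i a x [s [Ss Hs]]].
  + exact: sub_add.
  + exists (s + u); split; first exact: SD.
    by rewrite opprD addrACA; apply: ID.
  + by exists (a *: s); split; [apply: SS | rewrite -scalerBr; apply: IS].
- by move=> i x /BS; apply: sub_add.
- move=> i x [s [/SZ Zs /image_sub Zi]]; rewrite -(subrK s x); exact: ZD.
- move=> l lj; case=> [|[|i]] x [s [Ss /= Hs]].
  + by move/eqP: Hs; rewrite subr_eq0 => /eqP ->; apply/sub_add/Sop => //; apply: ltnW.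
  + by move/eqP: Hs; rewrite subr_eq0 => /eqP ->; apply/sub_add/Sop => //; apply: ltnW.
  have {Hs} [y [Zy xE]] := Hs.
  (* The operators commute only up to [B]; the commutator is absorbed into the component in [S]. *)
  exists (s *m t l i.+2 - (y *m t l i *m t j i.+2 - y *m t j i *m t l i.+2)); split.
    apply: linear_familyB => //; first by apply: Sop => //; apply: ltnW.
    by apply/BS/tC => //; apply: ltnW.
  exists (y *m t l i); split; first by apply: tZ => //; apply: ltnW.
  by rewrite -[x](subrK s) xE mulmxDl opprB addrC -[_ - _ - _]addrA -opprD subrK.
Qed.

(** The submodules (S_k : t_j^a) + t_j Z replace the ideals of leading coefficients. They grow with
    k and a, so the diagonal chain together with the finitely many chains with a < [m0] bounds all
    of them. *)
Lemma hilbert_basis : noetherian_module j.+1.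
Proof.
move=> S subS monoS.
pose T k a := iter a colon (S k).
have subT k a : submodule j.+1 (T k a).
  by elim: a => [|a IH]; [apply: subS | exact: (submodule_colon IH)].
have monoTk k k' a : (k <= k')%N -> sub_family (T k a) (T k' a).
  move=> kk'; elim: a => [|a IH]; [exact: (family_le monoS kk') | exact: (colonS IH)].
have monoTa k a a' : (a <= a')%N -> sub_family (T k a) (T k a').
  by apply: (family_le (S := T k)) => c; exact: (sub_colon (subT k c)).
pose L k a := add_image (T k a).
have subL k a : submodule j (L k a) by apply: submodule_add_image.
have imL k a i x : Z x -> L k a i.+2 (x *m t j i).
  move=> Zx; have [[T0 _ _] _ _ _] := subT k a.
  by exists 0; split=> //; exists x; rewrite subr0.
have monoL k k' a a' : (k <= k')%N -> (a <= a')%N -> sub_family (L k a) (L k' a').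
  by move=> kk' aa'; apply: add_imageS => i x /(monoTk _ _ _ kk'); apply: monoTa.
have [|m0 Hm0] := quotient_noetherian (fun k => subL k k) _ (fun k => imL k k).
  by move=> k; exact: (monoL _ _ _ _ (leqnSn k) (leqnSn k)).
have [||m1 Hm1] := @uniform_bound (fun a m => forall k, sub_family (L k a) (L m a)) m0.
- by move=> a m m' mm' H k i x /H; apply: monoL.
- move=> a _; apply: (quotient_noetherian (fun k => subL k a) _ (fun k => imL k a)) => k.
  exact: (monoL _ _ _ _ (leqnSn k) (leqnn a)).
pose m := maxn m0 m1.
have Hm k a : sub_family (L k a) (L m a).
  case: (ltnP a m0) => [am0|m0a] i x Lx.
    by apply: (monoL m1); [apply: leq_maxr | | apply: Hm1 Lx].
  apply: (monoL m0 m m0 a) => //; first exact: leq_maxl.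
  by apply: (Hm0 (maxn k a)); apply: monoL Lx; [apply: leq_maxl | apply: leq_maxr].
(* Induction on the degree: x in (S_k : t_j^a) differs from an element of (S_m : t_j^a) by y t_j,
   where y has degree lower by 2 and lies in a colon module with exponent a + 1. *)
suff main N : forall i, (i < N)%N -> forall k a (x : 'rV_(b i)), T k a i x -> T m a i x.
  by exists m => k i x; apply: (main i.+1 i (ltnSn i) k 0%N).
elim: N => // N IH i iN k a x Tx.
have /Hm [s [Ts Hs]] : L k a i x.
  by exists x; rewrite subrr; split=> //; have [] := linear_image.
case: i iN x Tx s Ts Hs => [|[|i]] iN x Tx s Ts /= Hs.
- by move/eqP: Hs; rewrite subr_eq0 => /eqP ->.
- by move/eqP: Hs; rewrite subr_eq0 => /eqP ->.
have {Hs} [y [Zy xE]] := Hs.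
have Ty : T (maxn k m) a.+1 i y.
  split=> //; rewrite -xE; apply: linear_familyB.
  + by have [] := subT (maxn k m) a.
  + exact: monoTk (leq_maxl _ _) _ _ Tx.
  + exact: monoTk (leq_maxr _ _) _ _ Ts.
have [_ Ty'] := IH i (ltnW iN) _ a.+1 y Ty.
have [[_ TD _] _ _ _] := subT m a.
by rewrite -[x](subrK s) xE; apply: TD.
Qed.

End HilbertBasis.
End OperatorModule.

(** * Eisenbud operators *)

Section Resolutions.
Variables (Q : comNzRingType) (n : Q -> Prop) (f : seq Q).

Definition exact_mod (I : Q -> Prop) (b : nat -> nat) (D : forall i, 'M[Q]_(b i, b i.+1)) i :=
  forall v : 'cV_(b i.+1), mx_in I (D i *m v) ->
  exists w : 'cV_(b i.+2), mx_in I (v - D i.+1 *m w).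

(** The long exact homology sequence of multiplication by a, on elements: D u = a c gives D c = 0,
    so c = D w, and u - a w is a cycle modulo I. *)
Lemma exact_mod_adjoin (I : Q -> Prop) a (b : nat -> nat)
    (D : forall i, 'M[Q]_(b i, b i.+1)) i :
  is_ideal I -> (forall x, I (a * x) -> I x) -> D i *m D i.+1 = 0 ->
  exact_mod I D i -> exact_mod I D i.+1 -> exact_mod (adjoin I a) D i.+1.
Proof.
move=> hI rega DD ex1 ex2 u /mx_in_adjoin[c Hc].
have [w Hw] : exists w, mx_in I (c - D i.+1 *m w).
  apply: ex1 => r s; apply: rega.
  have : mx_in I (a *: (D i *m c)).
    have -> : a *: (D i *m c) = - (D i *m (D i.+1 *m u - a *: c)).
      by rewrite mulmxBr mulmxA DD mul0mx sub0r opprK -scalemxAr.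
    by apply: mx_inN => //; apply: mx_inMl.
  by move=> /(_ r s); rewrite mxE.
have [z Hz] : exists z, mx_in I (u - a *: w - D i.+2 *m z).
  apply: ex2; rewrite mulmxBr -scalemxAr.
  have -> : D i.+1 *m u - a *: (D i.+1 *m w) =
      (D i.+1 *m u - a *: c) + a *: (c - D i.+1 *m w).
    by rewrite scalerBr addrA subrK.
  by apply: mx_inD => //; apply: mx_inZ.
exists z => r s; exists (w r s).
by have := Hz r s; rewrite !mxE addrAC mulrC.
Qed.

Lemma exact_mod_extend (g : seq Q) (I : Q -> Prop) (b : nat -> nat)
    (D : forall i, 'M[Q]_(b i, b i.+1)) k :
  is_ideal I -> regular_mod I g -> (forall i, D i *m D i.+1 = 0) ->
  (forall i, (k <= i)%N -> exact_mod I D i) ->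
  forall i, (k + size g <= i)%N -> exact_mod (extend I g) D i.
Proof.
move=> hI reg DD; elim: g I k hI reg => [|a g IH] I k hI /=.
  by rewrite addn0.
move=> [rega reg] ex i; rewrite -addSnnS; apply: IH => //; first exact: adjoin_ideal.
case=> // {}i ki; apply: exact_mod_adjoin => //; apply: ex => //; exact: leqW.
Qed.

(** Cochains with values in k = Q/n are represented by row vectors over Q. For a resolution of M,
    cocycles modulo coboundaries form Ext(M, k). *)
Definition cocycle (b : nat -> nat) (D : forall i, 'M[Q]_(b i, b i.+1)) : row_family Q b :=
  fun i x => mx_in n (x *m D i).

Definition coboundary (b : nat -> nat) (D : forall i, 'M[Q]_(b i, b i.+1)) : row_family Q b :=
  fun i => if i is i'.+1 then fun x => exists y, mx_in n (x - y *m D i')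
           else fun x => mx_in n x.

(* The Eisenbud operators of a lift [D] to [Q] of a complex over [Q/(f_0, ..., f_(j-1))]. *)
Definition eisenbud_operators j (b : nat -> nat) (D : forall i, 'M[Q]_(b i, b i.+1))
    (t : nat -> forall i, 'M[Q]_(b i, b i.+2)) :=
  forall i, D i *m D i.+1 = \sum_(l < j) nth 0 f l *: t l i.

Hypotheses (noeth : noetherian Q) (loc : local_ring n).
Hypothesis fn : forall j, (j < size f)%N -> n (nth 0 f j).
Hypothesis reg : forall i, (i < size f)%N -> forall x,
  gen_ideal (take i f) (nth 0 f i * x) -> gen_ideal (take i f) x.

Let hn : is_ideal n. Proof. by case: loc. Qed.
Let I j := gen_ideal (take j f).
Let hI j : is_ideal (I j). Proof. exact: gen_ideal_ideal. Qed.

Lemma gen_ideal_take_sub j x : I j x -> n x.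
Proof.
apply: gen_ideal_sub => // i; rewrite size_take_min leq_min => /andP[ij isz].
by rewrite nth_take //; apply: fn.
Qed.

(** * The action of the operators on Ext *)

Section Cohomology.
Variables (b : nat -> nat) (D : forall i, 'M[Q]_(b i, b i.+1)).

Lemma linear_cocycle : linear_family (cocycle D).
Proof.
split=> [i|i x y Hx Hy|i a x Hx]; rewrite /cocycle.
- by rewrite mul0mx; apply: mx_in0.
- by rewrite mulmxDl; apply: mx_inD.
- by rewrite -scalemxAl; apply: mx_inZ.
Qed.

Lemma linear_coboundary : linear_family (coboundary D).
Proof.
split.
- by case=> [|i]; [exact: mx_in0 | exists 0; rewrite mul0mx subrr; apply: mx_in0].
- case=> [|i] x y; first exact: mx_inD.
  move=> [u Hu] [v Hv]; exists (u + v).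
  by rewrite mulmxDl opprD addrACA; apply: mx_inD.
- case=> [|i] a x; first exact: mx_inZ.
  by move=> [u Hu]; exists (a *: u); rewrite -scalemxAl -scalerBr; apply: mx_inZ.
Qed.

Lemma coboundary_in i (x : 'rV_(b i)) : mx_in n x -> coboundary D x.
Proof. by case: i x => [|i] x Hx //; exists 0; rewrite mul0mx subr0. Qed.

Variables (j : nat) (t : nat -> forall i, 'M[Q]_(b i, b i.+2)).
Hypotheses (jsz : (j <= size f)%N) (eis : eisenbud_operators j D t).

Lemma eisenbud_square_in i : mx_in n (D i *m D i.+1).
Proof.
rewrite eis; apply: mx_in_sum => // l _; apply: mx_inZl => //; apply: fn.
exact: leq_trans jsz.
Qed.

Lemma sub_coboundary_cocycle : sub_family (coboundary D) (cocycle D).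
Proof.
case=> [|i] x; first exact: mx_inMr.
move=> [y Hy]; rewrite /cocycle -(subrK (y *m D i) x) mulmxDl.
apply: mx_inD => //; first exact: mx_inMr.
by rewrite -mulmxA; apply: mx_inMl => //; apply: eisenbud_square_in.
Qed.

(** Both bracketings of D D D are expanded in f. The coefficients of the resulting syzygy lie in the
    ideal of f, so each operator is a chain map modulo that ideal. *)
Lemma eisenbud_commute_sum i :
  \sum_(l < j) nth 0 f l *: (D i *m t l i.+1 - t l i *m D i.+2) = 0.
Proof.
under eq_bigr => l _ do rewrite scalerBr scalemxAr scalemxAl.
by rewrite sumrB -mulmx_sumr -mulmx_suml -!eis mulmxA subrr.
Qed.

Lemma eisenbud_chain_map l i : (l < j)%N ->
  mx_in (I j) (D i *m t l i.+1 - t l i *m D i.+2).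
Proof.
exact: (mx_syzygy reg (M := fun l => D i *m t l i.+1 - t l i *m D i.+2) jsz
  (eisenbud_commute_sum i)).
Qed.

Lemma eisenbud_cocycle l i (x : 'rV_(b i)) : (l < j)%N ->
  cocycle D x -> cocycle D (x *m t l i).
Proof.
move=> lj Hx; rewrite /cocycle.
have -> : x *m t l i *m D i.+2 =
    x *m D i *m t l i.+1 - x *m (D i *m t l i.+1 - t l i *m D i.+2).
  by rewrite mulmxBr !mulmxA opprB addrC subrK.
apply: mx_inB => //; first exact: mx_inMr.
apply: mx_inMl => //; apply: (mx_in_sub (@gen_ideal_take_sub j)).
exact: eisenbud_chain_map.
Qed.

Lemma eisenbud_coboundary l i (x : 'rV_(b i)) : (l < j)%N ->
  coboundary D x -> coboundary D (x *m t l i).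
Proof.
move=> lj; case: i x => [|i] x; first by move=> Hx; apply: coboundary_in; exact: mx_inMr.
move=> [y Hy]; exists (y *m t l i).
have -> : x *m t l i.+1 - y *m t l i *m D i.+2 =
    (x - y *m D i) *m t l i.+1 + y *m (D i *m t l i.+1 - t l i *m D i.+2).
  by rewrite mulmxBl mulmxBr !mulmxA addrA subrK.
apply: mx_inD => //; first exact: mx_inMr.
apply: mx_inMl => //; apply: (mx_in_sub (@gen_ideal_take_sub j)).
exact: eisenbud_chain_map.
Qed.

(* The commutator of two Eisenbud operators is a homotopy, obtained by comparing
   coefficients of [f] in [D D t_l - t_l D D]. *)
Lemma eisenbud_commute l m i (x : 'rV_(b i)) : (l < j)%N -> (m < j)%N -> cocycle D x ->
  coboundary D (x *m t l i *m t m i.+2 - x *m t m i *m t l i.+2).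
Proof.
move=> lj mj Hx.
have Hs i' : exists s : nat -> 'M_(b i', b i'.+3),
    D i' *m t l i'.+1 - t l i' *m D i'.+2 = \sum_(m < j) nth 0 f m *: s m.
  by apply: mx_in_take => //; apply: eisenbud_chain_map.
have [s Es] := Hs i; have [s' Es'] := Hs i.+1.
pose C m := t m i *m t l i.+2 - t l i *m t m i.+2 - (s m *m D i.+3 + D i *m s' m).
have sumC : \sum_(m < j) nth 0 f m *: C m = 0.
  rewrite /C; under eq_bigr => k _ do rewrite !(scalerBr, scalerDr).
  rewrite !(sumrB, big_split) /=.
  have -> : \sum_(k < j) nth 0 f k *: (t k i *m t l i.+2) = D i *m D i.+1 *m t l i.+2.
    by rewrite eis mulmx_suml; apply: eq_bigr => k _; rewrite -scalemxAl.
  have -> : \sum_(k < j) nth 0 f k *: (t l i *m t k i.+2) = t l i *m (D i.+2 *m D i.+3).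
    by rewrite eis mulmx_sumr; apply: eq_bigr => k _; rewrite -scalemxAr.
  have -> : \sum_(k < j) nth 0 f k *: (s k *m D i.+3) =
      (D i *m t l i.+1 - t l i *m D i.+2) *m D i.+3.
    by rewrite Es mulmx_suml; apply: eq_bigr => k _; rewrite -scalemxAl.
  have -> : \sum_(k < j) nth 0 f k *: (D i *m s' k) =
      D i *m (D i.+1 *m t l i.+2 - t l i.+1 *m D i.+3).
    by rewrite Es' mulmx_sumr; apply: eq_bigr => k _; rewrite -scalemxAr.
  rewrite mulmxBl mulmxBr !mulmxA [X in _ - X]addrC addrA.
  by rewrite [X in _ - (X - _)]subrK subrr.
have HC : mx_in n (C m).
  by apply: (mx_in_sub (@gen_ideal_take_sub j)); apply: (mx_syzygy reg jsz sumC).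
exists (- (x *m s m)).
have -> : x *m t l i *m t m i.+2 - x *m t m i *m t l i.+2 - - (x *m s m) *m D i.+3 =
    - (x *m C m) - x *m D i *m s' m.
  rewrite /C !mulmxBr !mulmxDr !mulmxA mulNmx opprK.
  by rewrite !opprB [in RHS]addrAC addrK addrC.
apply: mx_inB => //; last exact: mx_inMr.
by apply: mx_inN => //; apply: mx_inMl.
Qed.

End Cohomology.

(** * The cone of the last operator *)

Definition prev (b : nat -> nat) i := if i is i'.+1 then b i' else 0%N.

Definition prev_mx (b c : nat -> nat) (X : forall i, 'M[Q]_(b i, c i.+1)) i :
  'M[Q]_(prev b i, c i) :=
  match i return 'M[Q]_(prev b i, c i) with 0 => 0 | i'.+1 => X i' end.

Definition cone_rank (b : nat -> nat) i := (b i + prev b i)%N.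

(* For [D D = a T] modulo an ideal [J] on which [a] is regular, this resolves over [Q/J]
   the module which [D] resolves over [Q/(J + (a))]. *)
Definition cone (b : nat -> nat) (D : forall i, 'M[Q]_(b i, b i.+1))
    (T : forall i, 'M[Q]_(b i, b i.+2)) (a : Q) i :
    'M[Q]_(cone_rank b i, cone_rank b i.+1) :=
  @block_mx Q (b i) (prev b i) (b i.+1) (b i) (D i) a%:M
    (- prev_mx (c := fun i => b i.+1) T i) (- prev_mx D i).

Lemma sum_block_mx m1 m2 p1 p2 k (A : nat -> 'M[Q]_(m1, p1)) (A2 : nat -> 'M_(m1, p2))
    (A3 : nat -> 'M_(m2, p1)) (A4 : nat -> 'M_(m2, p2)) :
  \sum_(l < k) nth 0 f l *: block_mx (A l) (A2 l) (A3 l) (A4 l) =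
  block_mx (\sum_(l < k) nth 0 f l *: A l) (\sum_(l < k) nth 0 f l *: A2 l)
           (\sum_(l < k) nth 0 f l *: A3 l) (\sum_(l < k) nth 0 f l *: A4 l).
Proof.
elim: k => [|k IH]; first by rewrite !big_ord0 block_mx0.
by rewrite !big_ord_recr /= IH scale_block_mx add_block_mx.
Qed.

Lemma mx_in_take_sum j m p (M : nat -> 'M[Q]_(m, p)) : (j <= size f)%N ->
  mx_in (I j) (\sum_(l < j) nth 0 f l *: M l).
Proof.
move=> jsz; apply: mx_in_sum => // l _; apply: mx_inZl => //.
have -> : nth 0 f l = nth 0 (take j f) l by rewrite nth_take.
by apply: gen_ideal_nth; rewrite size_takel.
Qed.

Section Cone.
Variables (b : nat -> nat) (D : forall i, 'M[Q]_(b i, b i.+1)) (j : nat).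
Variable t : nat -> forall i, 'M[Q]_(b i, b i.+2).
Hypotheses (jsz : (j < size f)%N) (eis : eisenbud_operators j.+1 D t).
Let a := nth 0 f j.
Let D' := cone D (t j) a.

Lemma eisenbud_last_chain_map i : mx_in (I j) (D i *m t j i.+1 - t j i *m D i.+2).
Proof.
apply: (mx_regular reg) => //.
have := eisenbud_commute_sum eis i; rewrite big_ord_recr /= addrC => /eqP.
rewrite addr_eq0 => /eqP ->; apply: (mx_inN (hI _)).
exact: (mx_in_take_sum (fun l => D i *m t l i.+1 - t l i *m D i.+2) (ltnW jsz)).
Qed.

Lemma cone_eisenbud : exists t', eisenbud_operators j D' t' /\
  forall l i (x : 'rV_(b i)), row_mx x 0 *m t' l i = row_mx (x *m t l i) (0 : 'rV_(b i.+1)).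
Proof.
have /dependent_choice [s Hs] i : exists s : nat -> 'M_(prev b i, b i.+2),
    prev_mx D i *m t j i - prev_mx (c := fun i => b i.+1) (t j) i *m D i.+1 =
    \sum_(l < j) nth 0 f l *: s l.
  case: i => [|i]; first by exists (fun=> 0); rewrite [LHS]flatmx0 [RHS]flatmx0.
  by apply: mx_in_take; [apply: ltnW | apply: eisenbud_last_chain_map].
(* The square of the cone is block triangular, with D D - a t_j in two consecutive degrees on the
   diagonal; [s] expands the corner, the failure of t_j to be a chain map. *)
exists (fun l i => @block_mx Q (b i) (prev b i) (b i.+2) (b i.+1) (t l i) 0 (s i l)
   (prev_mx (c := fun i => b i.+1) (t l) i)); split; last first.
  by move=> l i x; rewrite mul_row_block !mul0mx mulmx0 !addr0.
have eis' i : D i *m D i.+1 - a *: t j i = \sum_(l < j) nth 0 f l *: t l i.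
  by rewrite eis big_ord_recr addrK.
move=> i; rewrite (sum_block_mx _ (fun l => t l i) (fun=> 0) (s i)
  (prev_mx (c := fun i => b i.+1) ^~ i \o t)).
rewrite /D' /cone (@mulmx_block _ _ _ (b i.+1) (b i)) /=.
congr (@block_mx Q _ _ _ _ _ _ _ _).
- by rewrite mulmxN mul_scalar_mx eis'.
- rewrite mulmxN mul_scalar_mx mul_mx_scalar subrr big1 // => l _; exact: scaler0.
- by rewrite mulmxN !mulNmx opprK addrC Hs.
- case: i => [|i] /=; first by rewrite [LHS]flatmx0 [RHS]flatmx0.
  by rewrite mulmxN !mulNmx opprK mul_mx_scalar addrC eis'.
Qed.

Lemma cone_exact i : exact_mod (I j.+1) D i -> exact_mod (I j) D' i.
Proof.
move=> ex v.
pose u : 'cV_(b i.+1) := usubmx (v : 'cV_(b i.+1 + b i)).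
pose w : 'cV_(b i) := dsubmx (v : 'cV_(b i.+1 + b i)).
have -> : v = col_mx u w by rewrite vsubmxK.
rewrite /D' {1}/cone mul_block_col => /mx_in_col[Hu _].
have [u' Hu'] : exists u', mx_in (I j.+1) (u - D i.+1 *m u').
  apply: ex; rewrite -[D i *m u](addrK (a%:M *m w)); apply: (mx_inB (hI _)).
    by apply: mx_in_sub Hu => x; apply: gen_ideal_takeS.
  rewrite mul_scalar_mx; apply: (mx_inZl (hI _)).
  have -> : a = nth 0 (take j.+1 f) j by rewrite nth_take.
  by apply: gen_ideal_nth; rewrite size_takel.
have [w' Hw'] := mx_in_takeS jsz Hu'.
exists (col_mx u' w' : 'cV_(b i.+2 + b i.+1)).
rewrite /cone mul_block_col /= opp_col_mx add_col_mx; apply/mx_in_col; split.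
  by rewrite mul_scalar_mx opprD addrA.
(* The second component is verified after multiplication by a, which turns it into the cycle
   condition for the first row. *)
apply: (mx_regular reg) => //.
have -> : a *: (w - (- t j i *m u' + - D i *m w')) =
   (D i *m u + a%:M *m w) - D i *m (u - D i.+1 *m u' - a *: w')
   - (D i *m D i.+1 - a *: t j i) *m u'.
  rewrite mul_scalar_mx !mulNmx !mulmxBr mulmxBl mulmxA -scalemxAr -scalemxAl.
  move: (D i *m u) (D i *m D i.+1 *m u') (D i *m w') (t j i *m u') => X1 X2 X3 X4.
  by apply/matrixP => r s; rewrite !mxE; ring.
have -> : D i *m D i.+1 - a *: t j i = \sum_(l < j) nth 0 f l *: t l i.
  by rewrite eis big_ord_recr addrK.
apply: (mx_inB (hI _)); last first.
  by apply: (mx_inMr (hI _)); exact: (mx_in_take_sum (fun l => t l i) (ltnW jsz)).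
by apply: (mx_inB (hI _)); [exact: Hu | apply: (mx_inMl (hI _)); exact: Hw'].
Qed.


Lemma cone_cocycle i (x : 'rV_(b i)) :
  cocycle D x -> cocycle D' (row_mx x 0 : 'rV_(cone_rank b i)).
Proof.
move=> Hx; rewrite /cocycle /D' /cone mul_row_block !mul0mx !addr0; apply/mx_in_row; split=> //.
by rewrite mul_mx_scalar; apply: mx_inZl => //; apply: fn.
Qed.

(* The kernel of [x |-> (x, 0)] on cohomology is the image of [t_j]. *)
Lemma cone_kernel i (x : 'rV_(b i)) :
  coboundary D' (row_mx x 0 : 'rV_(cone_rank b i)) ->
  add_image (cocycle D) t j (coboundary D) x.
Proof.
case: i x => [|i] x.
  by move=> /mx_in_row[Hx _]; exists x; rewrite subrr.
rewrite /= => -[y]; rewrite -[y](@hsubmxK _ 1 (b i) (prev b i)).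
move: (lsubmx _) (rsubmx _) => psi omega {y}.
rewrite /D' /cone mul_row_block opp_row_mx add_row_mx => /mx_in_row[H1 H2].
case: i x psi omega H1 H2 => [|i] x psi omega /= H1 H2.
  exists x; rewrite subrr; split=> //; exists psi.
  by move: H1; rewrite oppr0 mulmx0 addr0.
exists (x + omega *m t j i); split.
  by exists psi; move: H1; rewrite mulmxN opprB addrA.
exists (- omega); rewrite opprD addNKr mulNmx; split=> //; rewrite /cocycle mulNmx.
have -> : - (omega *m D i) = - (0 - (psi *m a%:M + omega *m - D i)) - a *: psi.
  by rewrite sub0r opprK mul_mx_scalar mulmxN addrAC subrr add0r.
by apply: mx_inB => //; [apply: mx_inN | apply: mx_inZl => //; apply: fn].
Qed.

(** By [cone_kernel], Ext modulo the image of t_j embeds in the Ext of the cone. A chain in this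
    quotient is pushed forward, stabilizes there and is pulled back. *)
Lemma cone_noetherian t' : eisenbud_operators j D' t' ->
  (forall l i (x : 'rV_(b i)), row_mx x 0 *m t' l i = row_mx (x *m t l i) (0 : 'rV_(b i.+1))) ->
  noetherian_module (cocycle D') (coboundary D') t' j ->
  noetherian_module (cocycle D) (coboundary D) t j.+1.
Proof.
move=> eis' t'E noethM.
have [B0' BD' BZ'] := linear_coboundary D'.
apply: hilbert_basis.
- exact: linear_cocycle.
- exact: (sub_coboundary_cocycle jsz eis).
- by move=> l lj i x; apply: (eisenbud_cocycle jsz eis).
- by move=> l lj i x; apply: (eisenbud_commute jsz eis).
move=> L subL monoL imL.
pose S k : row_family Q (cone_rank b) := fun i x' =>
  exists x, L k i x /\ coboundary D' (x' - (row_mx x 0 : 'rV_(cone_rank b i))).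
have subS k : submodule (cocycle D') (coboundary D') t' j (S k).
  have [[L0 LD LZ] _ LZc Lop] := subL k; split.
  - split=> [i|i x y [u [Lu Hu]] [v [Lv Hv]]|i c x [u [Lu Hu]]].
    + by exists 0; rewrite row_mx0 subrr; split.
    + exists (u + v); split; first exact: LD.
      by rewrite -[0]addr0 -add_row_mx opprD addrACA; apply: BD'.
    + exists (c *: u); split; first exact: LZ.
      by rewrite -[0](scaler0 _ c) -scale_row_mx -scalerBr; apply: BZ'.
  - by move=> i x Bx; exists 0; rewrite row_mx0 subr0.
  - move=> i x [u [Lu Hu]]; rewrite -[x](subrK (row_mx u 0)).
    have [_ ZD _] := linear_cocycle D'; apply: ZD.
      exact: (sub_coboundary_cocycle (ltnW jsz) eis').
    by apply/cone_cocycle/LZc.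
  - move=> l lj i x [u [Lu Hu]]; exists (u *m t l i); split; first exact: Lop.
    by rewrite -t'E -mulmxBl; apply: (eisenbud_coboundary (ltnW jsz) eis').
have [|m Hm] := noethM S subS.
  by move=> k i x [u [/monoL Lu Hu]]; exists u.
exists m => k i x Lx.
have [|y [Ly Hy]] := Hm k i (row_mx x 0 : 'rV_(b i + prev b i)).
  by exists x; rewrite subrr.
have [[L0 LD LZ] BL _ _] := subL m.
rewrite -[x](subrK y); apply: (LD) => //.
move: Hy; rewrite opp_row_mx add_row_mx subrr => /cone_kernel [s [Bs Hs]].
rewrite -(subrK s (x - y)); apply: LD; last exact: BL.
case: i x Lx y Ly s Bs Hs => [|[|i]] x Lx y Ly s Bs /= Hs.
- by rewrite Hs; apply: L0.
- by rewrite Hs; apply: L0.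
by have [z [Zz ->]] := Hs; apply: imL.
Qed.

End Cone.

(** Reduction modulo the regular sequence g preserves exactness in high degrees, where duality over
    the residue field then makes Ext vanish. Finitely many degrees remain, each inside a finite free
    module. *)
Lemma koszul_noetherian (g : seq Q) (b : nat -> nat) (D : forall i, 'M[Q]_(b i, b i.+1)) t :
  regular_mod (fun x => x = 0) g -> (forall x, n x <-> extend (fun x => x = 0) g x) ->
  eisenbud_operators 0 D t -> (forall i, exact_mod (I 0) D i) ->
  noetherian_module (cocycle D) (coboundary D) t 0.
Proof.
move=> regg nE eis ex S subS monoS.
have h0 : is_ideal (fun x : Q => x = 0).
  by split=> //; split=> [x y -> ->|r x ->]; rewrite ?addr0 ?mulr0.
have I0 x : I 0 x <-> x = 0.
  rewrite /I take0; split=> [[r ->]|->]; first by rewrite big_ord0.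
  by apply: is_ideal0; apply: gen_ideal_ideal.
have DD i : D i *m D i.+1 = 0 by rewrite eis big_ord0.
have ex0 i : exact_mod (fun x => x = 0) D i.
  move=> v Hv; have [|w Hw] := ex i v; first by move=> r s; apply/I0.
  by exists w => r s; apply/I0.
have exn i : (size g <= i)%N -> exact_mod n D i.
  move=> gi v Hv; have := @exact_mod_extend g _ b D 0 h0 regg DD (fun i _ => ex0 i) i gi v.
  case=> [|w Hw]; first by apply: mx_in_sub Hv => x /nE.
  by exists w; apply: mx_in_sub Hw => x /nE.
have ZB i (x : 'rV_(b i.+1)) : (size g <= i)%N -> cocycle D x -> coboundary D x.
  move=> gi Hx; apply: (factor_through_kernel loc) => v /(exn i gi)[w Hw].
  rewrite -(subrK (D i.+1 *m w) v) mulmxDr mulmxA.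
  by apply: mx_inD => //; [apply: mx_inMl | apply: mx_inMr].
have [||m Hm] := @uniform_bound (fun i m => forall k x, S k i x -> S m i x) (size g).+1.
- by move=> i m m' mm' H k x /H; apply: (family_le monoS mm').
- move=> i _; apply: (noetherian_rV (S := fun k => S k i) noeth).
  + by move=> k; have [[H _ _] _ _ _] := subS k; apply: H.
  + by move=> k x y; have [[_ H _] _ _ _] := subS k; apply: H.
  + by move=> k a x; have [[_ _ H] _ _ _] := subS k; apply: H.
  + by move=> k; apply: monoS.
exists m => k i x; case: (ltnP i (size g).+1) => [ig|]; first exact: Hm.
case: i x => // i x gi Sx; have [_ BS _ _] := subS m; apply/BS/ZB => //.
by have [_ _ SZ _] := subS k; apply: SZ.
Qed.

Lemma eisenbud_noetherian (g : seq Q) j (b : nat -> nat)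
    (D : forall i, 'M[Q]_(b i, b i.+1)) t : (j <= size f)%N ->
  regular_mod (fun x => x = 0) g -> (forall x, n x <-> extend (fun x => x = 0) g x) ->
  eisenbud_operators j D t -> (forall i, exact_mod (I j) D i) ->
  noetherian_module (cocycle D) (coboundary D) t j.
Proof.
move=> jsz regg nE; elim: j b D t jsz => [|j IH] b D t jsz eis ex.
  exact: koszul_noetherian regg nE eis ex.
have [t' [eis' t'E]] := cone_eisenbud jsz eis.
apply: (cone_noetherian jsz eis eis' t'E); apply: IH => //; first exact: ltnW.
by move=> i; apply: cone_exact.
Qed.

(** The submodule over the operators generated by coboundaries and cocycles of degree at most m,
    given inductively to avoid sums over monomials in the operators. *)
Inductive generated_upto (b : nat -> nat) (D : forall i, 'M[Q]_(b i, b i.+1))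
    (t : nat -> forall i, 'M[Q]_(b i, b i.+2)) j m : forall i, 'rV[Q]_(b i) -> Prop :=
| generated_low i x : (i <= m)%N -> cocycle D x -> generated_upto D t j m (i := i) x
| generated_boundary i x : coboundary D x -> generated_upto D t j m (i := i) x
| generated_add i x y : generated_upto D t j m (i := i) x -> generated_upto D t j m (i := i) y ->
    generated_upto D t j m (i := i) (x + y)
| generated_scale i a x : generated_upto D t j m (i := i) x ->
    generated_upto D t j m (i := i) (a *: x)
| generated_op l i x : (l < j)%N -> generated_upto D t j m (i := i) x ->
    generated_upto D t j m (i := i.+2) (x *m t l i).

(** Ext is generated in degrees at most some m. For i >= m, if all operators vanished modulo n in
    degree i, minimality would leave only zero cocycles in degree i + 2 modulo n; but by minimality
    every basis vector is a cocycle. *)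
Lemma eisenbud_nonvanishing j (b : nat -> nat) (D : forall i, 'M[Q]_(b i, b i.+1)) t :
  (j <= size f)%N -> eisenbud_operators j D t -> (forall i, mx_in n (D i)) ->
  (forall i, 0 < b i)%N -> noetherian_module (cocycle D) (coboundary D) t j ->
  exists m, forall i, (m <= i)%N -> ~ forall l, (l < j)%N -> mx_in n (t l i).
Proof.
move=> jsz eis Dn bpos noethM.
have [||m Hm] := noethM (fun m i x => generated_upto D t j m (i := i) x).
- move=> k; split.
  + split=> [i|i x y|i a x]; [| exact: generated_add | exact: generated_scale].
    by apply: generated_boundary; have [] := linear_coboundary D.
  + by move=> i x; apply: generated_boundary.
  + have [_ ZD ZS] := linear_cocycle D.
    move=> i x; elim=> {i x} [i x _ //|i x|i x y _ Zx _ Zy|i a x _ Zx|l i x lj _ Zx].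
    * exact: (sub_coboundary_cocycle jsz eis).
    * exact: ZD.
    * exact: ZS.
    * exact: (eisenbud_cocycle jsz eis).
  + by move=> l lj i x; apply: generated_op.
- move=> k i x; elim=> {i x} [i x ik Zx|i x|i x y _ Hx _ Hy|i a x _ Hx|l i x lj _ Hx].
  + by apply: generated_low => //; apply: leqW.
  + exact: generated_boundary.
  + exact: generated_add.
  + exact: generated_scale.
  + exact: generated_op.
exists m => i mi tn.
(* The degree is a variable tied by an equation, so that induction on the derivation applies. *)
have gen_in i' (x : 'rV_(b i')) : generated_upto D t j m x -> i' = i.+2 -> mx_in n x.
  elim=> {i' x} [i' x i'm _ E|i' x Bx _|i' x y _ Hx _ Hy E|i' a x _ Hx E|l i' x lj _ _ [E]].
  - have : (i.+2 <= m)%N by rewrite -E.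
    by move=> /leq_trans /(_ mi); rewrite ltnNge leqnSn.
  - case: i' x Bx => // i' x [y Hy]; apply: mx_in_subK Hy _ => //; exact: mx_inMl.
  - by apply: mx_inD => //; [apply: Hx | apply: Hy].
  - by apply: mx_inZ => //; apply: Hx.
  - by subst i'; apply: mx_inMl => //; apply: tn.
have i0 : 'I_(b i.+2) by exact: (Ordinal (bpos i.+2)).
have := gen_in i.+2 (delta_mx 0 i0) _ erefl 0 i0.
rewrite mxE !eqxx => H; apply: loc.2.1; apply: H.
by apply: (Hm i.+2); apply: generated_low => //; apply: mx_inMl.
Qed.

End Resolutions.

Theorem theorem1p1 (Q : comNzRingType) (n : Q -> Prop) (f : seq Q) (e : seq nat)
  (b : nat -> nat) (D : forall i : nat, 'M[Q]_(b i, b i.+1)) :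
  regular_local_ring n ->
  (0 < size f)%N -> size e = size f ->
  (forall j, (j < size f)%N -> ideal_pow n 2 (nth 0 f j)) ->
  (* e_j = ord_Q(f_j) *)
  (forall j, (j < size f)%N ->
     ideal_pow n (nth 0%N e j) (nth 0 f j) /\
     ~ ideal_pow n (nth 0%N e j).+1 (nth 0 f j)) ->
  regular_seq f ->
  gr_regular_seq n f e ->
  (forall j, (j.+1 < size f)%N -> (nth 0%N e j.+1 <= nth 0%N e j)%N) ->
  (* D i lifts to Q the matrix of d_(i+1) : F_(i+1) -> F_i over A = Q/(f),
     F_i = A^(b i); M = coker d_1. *)
  (* minimality: entries of d_(i+1) lie in m = n/(f) *)
  (forall i r s, n (D i r s)) ->
  (* complex: d_(i+1) d_(i+2) = 0 over A *)
  (forall i r s, gen_ideal f ((D i *m D i.+1) r s)) ->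
  (* exactness at F_(i+1) over A *)
  (forall i (v : 'cV[Q]_(b i.+1)),
     (forall r s, gen_ideal f ((D i *m v) r s)) ->
     exists w : 'cV[Q]_(b i.+2),
       forall r s, gen_ideal f ((v - D i.+1 *m w) r s)) ->
  (* infinite projective dimension: all F_i nonzero *)
  (forall i, (0 < b i)%N) ->
  (* ord_A(d_(i+1)) <= ord_Q(f_1) - 1 for i >> 0, i.e. some entry of d_(i+1)
     is not in m^(ord_Q(f_1)) = (n^(ord f_1) + (f))/(f) *)
  exists N, forall i, (N <= i)%N ->
    exists r s, ~ ideal_add (ideal_pow n (nth 0%N e 0)) (gen_ideal f) (D i r s).
Proof.
move=> [noeth [loc [d [[pchain _] gens]]]] f0 _ f2 fe [reg _] greg emono Dn complex resol bpos.
have hn : is_ideal n by case: loc.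
have [g [regg nE]] := regular_local_seq noeth loc pchain gens.
have fn j : (j < size f)%N -> n (nth 0 f j) by move=> /f2; apply: ideal_powS_sub.
have /dependent_choice [t Ht] i : exists t : nat -> 'M_(b i, b i.+2),
    D i *m D i.+1 = \sum_(l < size f) nth 0 f l *: t l.
  by apply: mx_in_take => //; rewrite take_size => r s; apply: complex.
have eis : eisenbud_operators f (size f) D (fun l i => t i l) by [].
have noethM : noetherian_module (cocycle n D) (coboundary n D) (fun l i => t i l) (size f).
  apply: (eisenbud_noetherian noeth loc fn reg (leqnn _) regg nE eis) => i.
  by rewrite take_size => v Hv; apply: resol.
have [m Hm] := eisenbud_nonvanishing loc fn reg (leqnn _) eis Dn bpos noethM.
exists m => i mi; apply: NNPP => small; apply: (Hm i mi) => l lf r s.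
set p := nth 0%N e 0 in small *.
have le_e k : (k < size f)%N -> (nth 0%N e k <= p)%N.
  elim: k => // k IH kf; exact: leq_trans (emono k kf) (IH (ltnW kf)).
(* If the bound fails, D_i is congruent modulo (f) to a matrix with entries in n^p. *)
have [r' s'|G HG] := @mx_choice Q _ _
    (fun r s c => ideal_pow n p c /\ gen_ideal f (D i r s - c)).
  apply: NNPP => H; apply: small; exists r', s' => -[y [z [Hy [Hz E]]]].
  by apply: H; exists y; split=> //; rewrite E addrC addKr.
pose G' : 'M_(b i, b i.+1) := \matrix_(r, s) G r s.
have [U HU] : exists U : nat -> 'M_(b i, b i.+1), D i - G' = \sum_(l < size f) nth 0 f l *: U l.
  by apply: mx_in_take => //; rewrite take_size => r' s'; rewrite !mxE; case: (HG r' s').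
(* These are the coefficients of f in an entry of G' D_(i+1), which lies in n^(p+1) because D_(i+1)
   has entries in n. *)
pose a k := (t i k - U k *m D i.+1) r s.
have sumE : \sum_(k < size f) nth 0 f k * a k = (G' *m D i.+1) r s.
  have -> : G' *m D i.+1 = \sum_(k < size f) nth 0 f k *: (t i k - U k *m D i.+1).
    under eq_bigr => k _ do rewrite scalerBr scalemxAl.
    by rewrite sumrB -mulmx_suml -Ht -HU mulmxBl opprB addrC subrK.
  by rewrite summxE; apply: eq_bigr => k _; rewrite [RHS]mxE.
have [|a' [Ha' aE]] := @gr_regular_inter Q n hn f e greg (fun j jf => (fe j jf).1)
    (size f) p.+1 a (leqnn _).
  rewrite sumE mxE; apply: (ideal_sum _ (ideal_pow_ideal hn p.+1)) => k _.
  rewrite mxE -addn1; apply: ideal_pow_mul => //; first by case: (HG r k).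
  by apply: ideal_pow1.
(* Both families express the same element, so their difference is a syzygy of f. *)
have aa'n : n (a l - a' l).
  apply: (@gen_ideal_take_sub Q n f loc fn (size f)).
  apply: (regular_syzygy reg (a := fun k => a k - a' k)) => //.
  under eq_bigr => k _ do rewrite mulrBr.
  by rewrite sumrB aE subrr.
(* Since e_l <= p, the exponent p + 1 - e_l is positive. *)
have a'n : n (a' l).
  have := Ha' l lf; rewrite subSn; [exact: ideal_powS_sub | exact: le_e].
have -> : t i l r s = (a l - a' l) + a' l + (U l *m D i.+1) r s.
  by rewrite subrK /a; move: (U l *m _) => X; rewrite !mxE subrK.
apply: is_idealD => //; first exact: is_idealD.
exact: (mx_inMl hn).
Qed.
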